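(* Let $\alpha,\beta>-1$, let $w_{JS}(x)=x^{\alpha}(1-x)^{\beta}w_0(x)$ on $[0,1]$ be a shifted Jacobi-type weight as in the context, let $v_{JS}(x):=-\ln w_{JS}(x)$, and let $\{P_n\}$ be the associated monic orthogonal polynomials, with $h_n$, $\mathbf p(n)$, $\alpha_n$, $\beta_n$ as in the context. Define $$A_n(z):=\frac{1}{z-z^2}\left[\frac{1}{h_n}\int_{0}^{1}\frac{(z-z^2)v_{JS}'(z)-(x-x^2)v_{JS}'(x)}{z-x}P_n^2(x)w_{JS}(x)\,dx+2n+1\right],\qquad n\ge0,$$ with $A_{-1}(z):=0$, and $$B_n(z):=\frac{1}{z-z^2}\left[\frac{1}{h_{n-1}}\int_{0}^{1}\frac{(z-z^2)v_{JS}'(z)-(x-x^2)v_{JS}'(x)}{z-x}P_n(x)P_{n-1}(x)w_{JS}(x)\,dx+n(z-1)-\mathbf p(n)\right],\qquad n\ge1,$$ with $B_0(z):=0$. Then for all $n\ge0$ $$P_n'(z)=-B_n(z)P_n(z)+\beta_nA_n(z)P_{n-1}(z),$$ $$P_{n-1}'(z)=\bigl(B_n(z)+v_{JS}'(z)\bigr)P_{n-1}(z)-A_{n-1}(z)P_n(z).$$ Moreover, $$B_{n+1}(z)+B_n(z)=(z-\alpha_n)A_n(z)-v_{JS}'(z),\qquad n\ge 0,$$ $$1+(z-\alpha_n)\bigl(B_{n+1}(z)-B_n(z)\bigr)=\beta_{n+1}A_{n+1}(z)-\beta_nA_{n-1}(z),\qquad n\ge 0,$$ $$B_n^2(z)+v_{JS}'(z)B_n(z)+\sum_{j=0}^{n-1}A_j(z)=\beta_nA_n(z)A_{n-1}(z),\qquad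 n\ge 1.$$
   Context: Weight: $w_0$ is a positive continuously differentiable function on the interior $(0,1)$, bounded near the endpoints $0,1$; all moments $\int_0^1x^jw_{JS}(x)\,dx$, $j=0,1,\dots$, are finite. Polynomials: $P_0:=1$, $P_{-1}:=0$, and $P_j(x)=x^j+\mathbf p(j)x^{j-1}+\cdots+P_j(0)$ for $j\ge1$ are the unique monic polynomials with $\int_0^1P_i(x)P_j(x)w_{JS}(x)\,dx=h_j\delta_{ij}$ for $i,j\ge0$; $\mathbf p(j)$ is the coefficient of $x^{j-1}$ in $P_j$, with $\mathbf p(0):=0$. The recurrence coefficients are $\alpha_j=\mathbf p(j)-\mathbf p(j+1)$ ($j\ge0$) and $\beta_j=h_j/h_{j-1}$ ($j\ge1$), so that $xP_j=P_{j+1}+\alpha_jP_j+\beta_jP_{j-1}$. The symbol $\beta_0$ only occurs multiplied by $0$ and may be set to $0$. (The recurrence coefficients $\alpha_n,\beta_n$ are distinct from the exponents $\alpha,\beta$.) Range of $z$: the identities are understood for $z\in\mathbb C\setminus\{0,1\}$ at which $v_{JS}'(z)$ is defined and the integrals involved converge. For $z\in(0,1)$, $v_{JS}'(z)$ is the ordinary derivative; for $z\notin[0,1]$ it denotes the value at $z$ of an analytic continuation of $v_{JS}'$, assumed to exist. Integrals are understood as improper integrals where they are not absolutely convergent. A prime denotes differentiation. *)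

(* Defs.v *)
From Stdlib Require Import Reals ClassicalEpsilon.
From Coquelicot Require Import Coquelicot.

Open Scope R_scope.

(* [prev d u n] is u_{n-1}, with the convention u_{-1} = d. *)
Definition prev {T : Type} (d : T) (u : nat -> T) (n : nat) : T :=
  match n with
  | O => d
  | S m => u m
  end.

(* A sequence of polynomials with deg P_n <= n is given by its coefficients:
   [P n k] is the coefficient of x^k in P_n, and only k <= n is ever used. *)
Definition poly_R (P : nat -> nat -> R) (n : nat) (x : R) : R :=
  sum_n (fun k : nat => P n k * x ^ k) n.

Definition poly_C (P : nat -> nat -> R) (n : nat) (z : C) : C :=
  sum_n (fun k : nat => (RtoC (P n k) * z ^ k)%C) n.

Definition prev_poly_C (P : nat -> nat -> R) (n : nat) (z : C) : C :=
  prev (RtoC 0) (fun m : nat => poly_C P m z) n.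

Definition subleading (P : nat -> nat -> R) (n : nat) : R :=
  prev 0 (fun m : nat => P (S m) m) n.

Definition weight (a b : R) (w0 : R -> R) (x : R) : R :=
  Rpower x a * Rpower (1 - x) b * w0 x.

Definition potential (w : R -> R) (x : R) : R := - ln (w x).

(* Improper integrals over (0,1) of functions that are continuous there are
   taken in the sense of [is_RInt_gen] along [at_right 0], [at_left 1]. *)
Record jacobi_type (a b : R) (w0 : R -> R) : Prop := {
  jacobi_pos : forall x : R, 0 < x < 1 -> 0 < w0 x;
  jacobi_derivable : forall x : R, 0 < x < 1 -> ex_derive w0 x;
  jacobi_C1 : forall x : R, 0 < x < 1 -> continuous (Derive w0) x;
  jacobi_bounded_0 : exists M : R, at_right 0 (fun x => Rabs (w0 x) <= M);
  jacobi_bounded_1 : exists M : R, at_left 1 (fun x => Rabs (w0 x) <= M);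
  jacobi_moments : forall j : nat,
    ex_RInt_gen (fun x => x ^ j * weight a b w0 x) (at_right 0) (at_left 1)
}.

Record monic_orthogonal (w : R -> R) (P : nat -> nat -> R) (h : nat -> R)
  : Prop := {
  mo_monic : forall n : nat, P n n = 1;
  mo_orthogonal : forall i j : nat,
    is_RInt_gen (fun x => poly_R P i x * poly_R P j x * w x)
      (at_right 0) (at_left 1) (if Nat.eq_dec i j then h j else 0)
}.

Definition rec_alpha (P : nat -> nat -> R) (n : nat) : R :=
  subleading P n - subleading P (S n).

Definition rec_beta (h : nat -> R) (n : nat) : R :=
  match n with
  | O => 0
  | S m => h (S m) / h m
  end.

Definition in_open01 (z : C) : Prop := exists x : R, 0 < x < 1 /\ z = RtoC x.

Definition in_closed01 (z : C) : Prop := exists x : R, 0 <= x <= 1 /\ z = RtoC x.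

Definition connected_C (U : C -> Prop) : Prop :=
  forall V W : C -> Prop,
    open V -> open W ->
    (forall u : C, U u -> V u \/ W u) ->
    (exists u : C, U u /\ V u) ->
    (exists u : C, U u /\ W u) ->
    exists u : C, U u /\ V u /\ W u.

Definition holomorphic_on (F : C -> C) (U : C -> Prop) : Prop :=
  forall u : C, U u -> @ex_derive C_AbsRing C_NormedModule F u.

(* On some domain (connected open set) containing (0,1) and z, the function
   [F] is an analytic continuation of [f], defined on (0,1). *)
Definition continues_to (f : R -> R) (F : C -> C) (z : C) : Prop :=
  exists U : C -> Prop,
    open U /\ connected_C U /\ U z /\
    (forall x : R, 0 < x < 1 -> U (RtoC x) /\ F (RtoC x) = RtoC (f x)) /\
    holomorphic_on F U.

(* z is a point of C \ {0,1} at which the derivative of the potential of [w]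
   is defined, with value [dv z]. *)
Definition admissible (w : R -> R) (dv : C -> C) (z : C) : Prop :=
  (exists x : R, 0 < x < 1 /\ z = RtoC x /\
     dv z = RtoC (Derive (potential w) x))
  \/
  (~ in_closed01 z /\ continues_to (Derive (potential w)) dv z).

(* For z in (0,1) the integrands below have a possible singularity at x = z,
   and both one-sided improper integrals are required to converge. *)
Definition ex_int01 (f : R -> C) (z : C) : Prop :=
  (in_open01 z ->
     @ex_RInt_gen C_R_NormedModule f (at_right 0) (at_left (Re z)) /\
     @ex_RInt_gen C_R_NormedModule f (at_right (Re z)) (at_left 1)) /\
  (~ in_open01 z ->
     @ex_RInt_gen C_R_NormedModule f (at_right 0) (at_left 1)).

Definition int01 (f : R -> C) (z : C) : C :=
  if excluded_middle_informative (in_open01 z) then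
    (@RInt_gen C_R_CompleteNormedModule f (at_right 0) (at_left (Re z)) +
     @RInt_gen C_R_CompleteNormedModule f (at_right (Re z)) (at_left 1))%C
  else
    @RInt_gen C_R_CompleteNormedModule f (at_right 0) (at_left 1).

Definition ladder_kernel (w : R -> R) (dv : C -> C) (z : C) (x : R) : C :=
  (((z - z ^ 2) * dv z - RtoC ((x - x ^ 2) * Derive (potential w) x))
     / (z - RtoC x))%C.

Definition A_integrand (w : R -> R) (P : nat -> nat -> R) (dv : C -> C)
    (n : nat) (z : C) (x : R) : C :=
  (ladder_kernel w dv z x * RtoC (poly_R P n x ^ 2 * w x))%C.

(* The integrand of B_{m+1}. *)
Definition B_integrand (w : R -> R) (P : nat -> nat -> R) (dv : C -> C)
    (m : nat) (z : C) (x : R) : C :=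
  (ladder_kernel w dv z x * RtoC (poly_R P (S m) x * poly_R P m x * w x))%C.

Definition A (w : R -> R) (P : nat -> nat -> R) (h : nat -> R) (dv : C -> C)
    (n : nat) (z : C) : C :=
  (/ (z - z ^ 2) *
   (/ RtoC (h n) * int01 (A_integrand w P dv n z) z
    + RtoC (2 * INR n + 1)))%C.

Definition prev_A (w : R -> R) (P : nat -> nat -> R) (h : nat -> R)
    (dv : C -> C) (n : nat) (z : C) : C :=
  prev (RtoC 0) (fun m : nat => A w P h dv m z) n.

Definition B (w : R -> R) (P : nat -> nat -> R) (h : nat -> R) (dv : C -> C)
    (n : nat) (z : C) : C :=
  match n with
  | O => RtoC 0
  | S m =>
      (/ (z - z ^ 2) *
       (/ RtoC (h m) * int01 (B_integrand w P dv m z) z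
        + RtoC (INR n) * (z - 1) - RtoC (subleading P n)))%C
  end.

Definition A_converges (w : R -> R) (P : nat -> nat -> R) (dv : C -> C)
    (n : nat) (z : C) : Prop :=
  ex_int01 (A_integrand w P dv n z) z.

(* No integral is involved in A_{-1} = 0 and B_0 = 0. *)
Definition prev_A_converges (w : R -> R) (P : nat -> nat -> R) (dv : C -> C)
    (n : nat) (z : C) : Prop :=
  prev True (fun m : nat => A_converges w P dv m z) n.

Definition B_converges (w : R -> R) (P : nat -> nat -> R) (dv : C -> C)
    (n : nat) (z : C) : Prop :=
  prev True (fun m : nat => ex_int01 (B_integrand w P dv m z) z) n.

(* Main.v *)
(** Let [L] be the moment functional of [w], put [c = (z - z^2) v'(z)] and let [K] be the ladder
    kernel. Integration by parts, whose boundary terms vanish because [a, b > -1], gives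
    [int K (z - x) r w = c L(r) - L(((x - x^2) r)')] for every polynomial [r], whatever the value
    of [v'(z)] is. Hence, if [lam] denotes [int K w] when this integral converges and [0]
    otherwise, the linear functional [J] on polynomials with [J(1) = lam] and
    [J(x r) = z J(r) - c L(r) + L(((x - x^2) r)')] agrees with [q |-> int K q w] at every [q] for
    which the latter converges; when [int K w] diverges, such [q] are those with [q(z) = 0], so
    that the choice of [lam] is immaterial. Replacing the integrals by [J] thus defines [A_n] and
    [B_n] for all [n], and it suffices to prove all relations for these.

    With [r = P_n^2] and [r = P_n (P_{n+1} - be_n P_{n-1})], and the recurrence for [P_n], the
    rule for [J] is exactly the first two compatibility relations. Multiplying the second one by
    [A_n] and using the first one gives a telescoping sum, which is the sum rule. The two ladder
    relations follow from the compatibility relations by induction on [n]. *)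

Require Import Defs.
From mathcomp Require all_boot all_algebra ring Rstruct.
From Stdlib Require Import Reals Lra.
From Coquelicot Require Import Coquelicot.

Open Scope R_scope.
Set Bullet Behavior "Strict Subproofs".

(** * Orthogonal polynomials *)

Module OrthogonalPolynomials.
Import all_boot all_algebra ring.
Import GRing.Theory.
Set Implicit Arguments.
Unset Strict Implicit.
Unset Printing Implicit Defensive.
Local Open Scope ring_scope.

Section Orthogonal.
Context (F : fieldType) (L : {poly F} -> F).
Context (LD : forall p q, L (p + q) = L p + L q).
Context (LZ : forall a p, L (a%:P * p) = a * L p).
Context (P : nat -> {poly F}) (h : nat -> F).
Context (sizeP : forall n, size (P n) = n.+1) (monicP : forall n, (P n)`_n = 1).
Context (LPP : forall i j, L (P i * P j) = if i == j then h j else 0).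
Context (h_neq0 : forall n, h n != 0).

(** [subl n] is the subleading coefficient p(n), [al] and [be] are the recurrence coefficients and
    [Pprev] encodes P_{-1} = 0. They are set over an abstract field, for any linear functional with
    orthogonal [P]. *)
Definition subl n := if n is m.+1 then (P m.+1)`_m else 0.
Definition al n := subl n - subl n.+1.
Definition be n := if n is m.+1 then h m.+1 / h m else 0.
Definition Pprev n := if n is m.+1 then P m else 0.

Lemma L0 : L 0 = 0.
Proof. by rewrite -(mulr0 0%:P) LZ mul0r. Qed.

Lemma LN (p : {poly F}) : L (- p) = - L p.
Proof. by rewrite -mulN1r -polyCN LZ mulN1r. Qed.

Lemma LB (p q : {poly F}) : L (p - q) = L p - L q.
Proof. by rewrite LD LN. Qed.

(** Induction on the degree bound with [m] fixed: subtracting a multiple of P_k removes the top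
    coefficient and leaves the value of [L] unchanged, because k < m. *)
Lemma L_low (p : {poly F}) m : (size p <= m)%N -> L (p * P m) = 0.
Proof.
suff H k : forall q : {poly F}, (size q <= k)%N -> (k <= m)%N -> L (q * P m) = 0.
  by move=> sp; apply: (H m).
elim: k => [|k IH] q sq km.
  by move: sq; rewrite leqn0 size_poly_eq0 => /eqP ->; rewrite mul0r L0.
rewrite (_ : q * P m = (q - q`_k *: P k) * P m + (q`_k)%:P * (P k * P m)); last first.
  by rewrite -mul_polyC; ring.
rewrite LD LZ LPP (ltn_eqF km) mulr0 addr0 IH // ?(ltnW km) //.
apply/leq_sizeP => j; rewrite leq_eqVlt => /orP [/eqP <-|kj].
  by rewrite coefB coefZ monicP mulr1 subrr.
by rewrite coefB coefZ (nth_default _ (leq_trans sq kj)) (nth_default _ (s := P k)) ?sizeP // mulr0 subr0.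
Qed.

(** Subtracting multiples of P_{m+1} and then of P_m leaves a remainder of degree below m, which
    [L_low] kills. The coefficient of P_m in this expansion is what survives. All later moments are
    read off from two coefficients in this way. *)
Lemma L_top (p : {poly F}) m : (size p <= m.+2)%N ->
  L (p * P m) = (p`_m - p`_m.+1 * subl m.+1) * h m.
Proof.
move=> sp; pose q := p - p`_m.+1 *: P m.+1; pose r := q - q`_m *: P m.
have sr : (size r <= m)%N.
  apply/leq_sizeP => j; rewrite leq_eqVlt => /orP [/eqP <-|].
    by rewrite coefB coefZ monicP mulr1 subrr.
  rewrite leq_eqVlt => /orP [/eqP <-|mj].
    rewrite /r /q !coefB !coefZ monicP mulr1 subrr (nth_default 0 (s := P m)) ?sizeP //.
    by rewrite mulr0 subrr.
  rewrite /r /q !coefB !coefZ (nth_default _ (leq_trans sp mj)).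
  rewrite (nth_default _ (s := P m.+1)) ?sizeP // (nth_default _ (s := P m)) ?sizeP ?(ltnW mj) //.
  by rewrite !mulr0 !subr0.
have -> : p * P m = r * P m + ((q`_m)%:P * (P m * P m) + (p`_m.+1)%:P * (P m.+1 * P m)).
  by rewrite /r /q -!mul_polyC; ring.
rewrite !LD !LZ !LPP eqxx gtn_eqF // (L_low sr) /q coefB coefZ /subl; ring.
Qed.

Lemma LPprev n : L (Pprev n * P n) = 0.
Proof. by case: n => [|n]; rewrite ?mul0r ?L0 //= LPP ltn_eqF. Qed.

Lemma size_XP n : (size ('X * P n)%R <= n.+2)%N.
Proof. by rewrite (leq_trans (size_polyMleq _ _)) // size_polyX sizeP. Qed.

Lemma LXPP n : L ('X * P n * P n) = al n * h n.
Proof.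
rewrite L_top ?size_XP // !coefXM /= monicP mul1r /al /subl.
by case: n.
Qed.

Lemma LXPS n : L ('X * P n * P n.+1) = h n.+1.
Proof.
by rewrite L_top ?(leq_trans (size_XP n)) // !coefXM /= monicP nth_default
   ?sizeP // mul0r subr0 mul1r.
Qed.

(** Since h_n is nonzero, pairing with P_n detects the coefficient of x^n, so the coefficients
    vanish one after the other from the top. *)
Lemma eq0_of_L (p : {poly F}) n : (size p <= n)%N ->
  (forall k, (k < n)%N -> L (p * P k) = 0) -> p = 0.
Proof.
elim: n => [|n IH] sp Hp; first by apply/eqP; rewrite -size_poly_eq0 -leqn0.
have pn : p`_n = 0.
  have := Hp n (ltnSn n); rewrite L_top ?(leq_trans sp) //.
  rewrite (nth_default _ sp) mul0r subr0 => /eqP.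
  by rewrite mulf_eq0 (negbTE (h_neq0 n)) orbF => /eqP.
apply: IH => [|k kn]; last by apply: Hp; rewrite ltnW.
apply/leq_sizeP => j; rewrite leq_eqVlt => /orP [/eqP <- //|nj].
by rewrite nth_default // (leq_trans sp).
Qed.

(** The difference of the two sides has degree at most n + 1, so by [eq0_of_L] it is enough to pair
    it with P_k for k <= n + 1. *)
Lemma recurrence n : 'X * P n = P n.+1 + (al n)%:P * P n + (be n)%:P * Pprev n.
Proof.
apply/eqP; rewrite -subr_eq0; apply/eqP.
(* Multiplication by X is symmetric for the pairing; moving it to P_k makes that factor of low
   degree when k < n. *)
set q := (_ - _); have qE k : L (q * P k) = L (('X * P k) * P n) -
    (L (P n.+1 * P k) + al n * L (P n * P k) + be n * L (Pprev n * P k)).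
  by rewrite -!LZ -!LD -LB; congr L; rewrite /q; ring.
have sq : (size q <= n.+2)%N.
  have szP m : (m <= n.+1)%N -> (size (P m) <= n.+2)%N by rewrite sizeP ltnS.
  have szPp : (size (Pprev n) <= n.+2)%N.
    by case: (n) szP => [|m] szP; rewrite ?size_poly0 // szP // (leq_trans (leqnSn m)).
  apply/leq_sizeP => j nj; rewrite /q coefB !coefD !coefCM.
  rewrite (nth_default _ (leq_trans (size_XP n) nj)) (nth_default _ (leq_trans szPp nj)).
  rewrite (nth_default _ (leq_trans (szP _ (leqnn _)) nj)).
  by rewrite (nth_default _ (leq_trans (szP _ (leqnSn _)) nj)) !mulr0 !addr0 subrr.
apply: (eq0_of_L sq) => k kn; rewrite qE.
have LPl j : (j < k)%N -> L (P j * P k) = 0 by move=> jk; rewrite LPP ltn_eqF.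
have LPg j : (k < j)%N -> L (P j * P k) = 0 by move=> jk; rewrite LPP gtn_eqF.
have swap : L ('X * P k * P n) = L ('X * P n * P k) by congr L; ring.
case: (ltngtP k n) => [lt_kn|lt_nk|->].
- rewrite LPg ?(leq_trans lt_kn) // LPg // mulr0 addr0 add0r.
  (* Here n = m + 1. For k = m the remaining terms are h_n and be_n h_m, which agree; for k < m the
     polynomial X P_k has degree below n. *)
  case: n lt_kn {kn qE swap sq q} => [//|m]; rewrite ltnS leq_eqVlt => /orP [/eqP -> | km] /=.
    by rewrite LXPS LPP eqxx divfK // subrr.
  rewrite LPP gtn_eqF // mulr0 subr0 L_low // (leq_trans (size_XP k)) //.
- rewrite swap; have -> : k = n.+1 by apply/eqP; rewrite eqn_leq lt_nk -ltnS kn.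
  rewrite LXPS LPP eqxx LPP ltn_eqF // mulr0 addr0.
  case: (n) => [|m] /=; rewrite ?mul0r ?L0 ?mulr0 ?addr0 ?subrr //.
  by rewrite LPP ltn_eqF ?mulr0 ?addr0 ?subrr // ltnW.
- by rewrite LXPP LPP gtn_eqF // LPP eqxx LPprev mulr0 add0r addr0 subrr.
Qed.

(** * Moments of derivatives of orthogonal polynomials *)

Local Notation D n := ((P n)^`()).

Lemma size_D n : (size (D n) <= n)%N.
Proof.
apply/leq_sizeP => j nj; rewrite coef_deriv nth_default ?mul0rn // sizeP.
by rewrite ltnS.
Qed.

Lemma size_XnD k n : (size ('X^k * D n)%R <= n + k)%N.
Proof.
apply/leq_sizeP => j nj; rewrite coefXnM; case: ifP => // /negbT; rewrite -leqNgt => kj.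
by rewrite nth_default // (leq_trans (size_D n)) // leq_subRL // addnC.
Qed.

Lemma coef_XD n k : ('X * D n)`_k = (P n)`_k * k%:R.
Proof. by rewrite coefXM coef_deriv mulr_natr; case: k => [|k]. Qed.

Lemma coef_X2D n k : ('X^2 * D n)`_k.+1 = (P n)`_k * k%:R.
Proof. by rewrite exprS expr1 -mulrA coefXM /= coef_XD. Qed.

Lemma L_XDP n m : (n <= m.+1)%N ->
  L ('X * D n * P m) = ((P n)`_m * m%:R - (P n)`_m.+1 * m.+1%:R * subl m.+1) * h m.
Proof.
move=> nm; rewrite L_top ?coef_XD //.
by rewrite -['X]expr1 (leq_trans (size_XnD _ _)) // addn1 ltnS.
Qed.

Lemma L_X2DP n m : (n <= m)%N ->
  L ('X^2 * D n * P m.+1) = (P n)`_m * m%:R * h m.+1.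
Proof.
move=> nm; rewrite L_top ?coef_X2D //.
  by rewrite (@nth_default _ 0 (P n) m.+1) ?sizeP ?ltnS //; ring.
by rewrite (leq_trans (size_XnD _ _)) // addn2 !ltnS ltnW.
Qed.

Lemma L_X2DPn n : L ('X^2 * D n * P n) = ((n%:R - 1) * subl n - n%:R * subl n.+1) * h n.
Proof.
rewrite L_top ?(leq_trans (size_XnD _ _)) ?addn2 // coef_X2D monicP.
case: n => [|n] /=; rewrite ?coef_X2D.
  by rewrite exprS expr1 -mulrA coefXM /= /subl; ring.
ring.
Qed.

(** The derivative is (1 - 2x) P_n^2 + 2 (x - x^2) P_n P_n'. Each of its four terms pairs P_n with a
    factor of degree at most n + 1, so [L_top] evaluates it. The value accounts for the explicit
    terms 2n + 1 and n(z - 1) - p(n) of A_n and B_n in the first compatibility relation. *)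
Lemma L_ibp_square n :
  L ((('X - 'X^2) * (P n * P n))^`()) =
  ((2 * n%:R + 1) * (1 - al n) + subl n + subl n.+1) * h n.
Proof.
rewrite derivM derivB derivX derivXn derivM.
have -> : (1 - 'X^1 *+ 2) * (P n * P n) + ('X - 'X^2) * (D n * P n + P n * D n) =
   P n * P n - 2%:R%:P * ('X * P n * P n) + 2%:R%:P * ('X * D n * P n - 'X^2 * D n * P n).
  by rewrite expr1; ring.
rewrite LD LB !LZ LB LPP eqxx LXPP L_X2DPn L_XDP // monicP.
by rewrite (nth_default _ (s := P n)) ?sizeP // /al; ring.
Qed.

Lemma deriv_recurrence n :
  D n.+1 = P n + ('X - (al n)%:P) * D n - (be n)%:P * (Pprev n)^`().
Proof.
have /(congr1 (@deriv F)) := recurrence n.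
rewrite derivM derivX !derivD !derivM !derivC => E.
have -> : D n.+1 = (1 * P n + 'X * D n) -
    (0 * P n + (al n)%:P * D n + (0 * Pprev n + (be n)%:P * (Pprev n)^`())).
  by rewrite E; ring.
ring.
Qed.

(** The same computation for the polynomial behind the second compatibility relation. All terms but
    two fall within the reach of [L_top]. *)
Lemma L_ibp_step n :
  L ((('X - 'X^2) * (P n * (P n.+1 - (be n)%:P * Pprev n)))^`()) =
  (al n - al n ^+ 2) * h n - (2 * n%:R + 3) * h n.+1 + (2 * n%:R - 1) * (be n * h n).
Proof.
rewrite derivM derivB derivX derivXn derivM derivB derivM derivC.
set dQ := (Pprev n)^`(); set Q := Pprev n.
(* The products x^2 P_n P_{n+1}' and x^2 P_n' P_{n-1} exceed the degrees allowed in [L_top]. In this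
   combination the recurrence and its derivative reduce them to products that it covers. *)
have X2PD : 'X^2 * P n * D n.+1 - (be n)%:P * ('X^2 * D n * Q) =
    'X * P n * P n.+1 + (al n)%:P * ('X * P n * P n) + (be n)%:P * ('X * P n * Q)
    + 'X^2 * D n * P n.+1 - (be n)%:P * ('X^2 * dQ * P n).
  have := recurrence n; rewrite -/Q => rn.
  rewrite deriv_recurrence -/dQ.
  have -> : P n.+1 = 'X * P n - (al n)%:P * P n - (be n)%:P * Q by rewrite rn; ring.
  ring.
have -> : (1 - 'X^1 *+ 2) * (P n * (P n.+1 - (be n)%:P * Q)) +
     ('X - 'X^2) * (D n * (P n.+1 - (be n)%:P * Q) +
        P n * (D n.+1 - (0 * Q + (be n)%:P * dQ))) =
   P n * P n.+1 - (be n)%:P * (Q * P n)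
   - 2%:R%:P * ('X * P n * P n.+1 - (be n)%:P * ('X * P n * Q))
   + 'X * D n * P n.+1 - (be n)%:P * ('X * D n * Q) + 'X * D n.+1 * P n
   - (be n)%:P * ('X * dQ * P n) - 'X^2 * D n * P n.+1
   + (be n)%:P * ('X^2 * dQ * P n)
   - ('X^2 * P n * D n.+1 - (be n)%:P * ('X^2 * D n * Q)).
  by rewrite expr1; ring.
have LQP : L (Q * P n) = 0 := LPprev n.
(* At n = 0 the moment is 0 while h_0 is not, so the factor be_n, which is 0 there, has to stay on
   both sides. *)
have LXPQ : be n * L ('X * P n * Q) = be n * h n.
  rewrite /be /Q; case: (n) => [|m] /=; first by rewrite !mul0r.
  by rewrite [_ * P m](_ : _ = 'X * P m * P m.+1) ?LXPS //; ring.
have LXDQ : be n * L ('X * D n * Q) = - subl n * h n.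
  rewrite /be /Q; case: (n) => [|m] /=; first by rewrite !mul0r oppr0 mul0r.
  by rewrite L_XDP // monicP /subl; field; apply: h_neq0.
have LXdQP : L ('X * dQ * P n) = 0.
  rewrite /dQ /Q; case: (n) => [|m] /=; first by rewrite derivC mulr0 mul0r L0.
  by rewrite L_XDP ?leqW // (@nth_default _ 0 (P m) m.+1) ?sizeP // nth_default ?sizeP //; ring.
have LX2dQP : be n * L ('X^2 * dQ * P n) = be n * (n%:R - 1) * h n.
  rewrite /dQ /Q /be; case: (n) => [|m] /=; first by rewrite !mul0r.
  by rewrite L_X2DP // monicP; ring.
have LXDP1 : L ('X * D n * P n.+1) = 0.
  by rewrite L_XDP ?leqW // (@nth_default _ 0 (P n) n.+1) ?sizeP // nth_default ?sizeP //; ring.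
rewrite X2PD !(LD, LN, LZ) LXPQ LXDQ LXdQP LX2dQP LXDP1 LQP LPP (ltn_eqF (ltnSn n)).
rewrite LXPS LXPP L_XDP // L_X2DP // !monicP -[(P n.+1)`_n]/(subl n.+1) /al; ring.
Qed.

(** This is P_n (P_{n+1} - be_n P_{n-1}), expanded so that a linear functional can be applied
    termwise to the products that occur in the integrals of B_{n+1} and B_n. *)
Definition step n := P n.+1 * P n + (- be n)%:P * (P n * Pprev n).

Lemma stepE n : P n * (P n.+1 - (be n)%:P * Pprev n) = step n.
Proof. by rewrite /step; ring. Qed.

Lemma L_step n : L (step n) = 0.
Proof. by rewrite /step LD LZ LPP gtn_eqF // [P n * _]mulrC LPprev mulr0 addr0. Qed.

Lemma X_square n :
  'X * (P n * P n) = P n.+1 * P n + (al n)%:P * (P n * P n) + (be n)%:P * (P n * Pprev n).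
Proof. by rewrite mulrA recurrence; ring. Qed.

(** A difference of squares: replacing X P_n by the recurrence, the mixed products P_{n+1} P_{n-1}
    cancel, so that only squares and products of neighbours remain. *)
Lemma X_step n : 'X * step n =
  P n.+1 * P n.+1 + (al n)%:P * (P n.+1 * P n) + (- (al n * be n))%:P * (P n * Pprev n)
  + (- (be n ^+ 2))%:P * (Pprev n * Pprev n).
Proof. by rewrite -stepE mulrA recurrence; ring. Qed.

End Orthogonal.
End OrthogonalPolynomials.

(** * Improper integrals over (0,1) *)

Lemma at_right_between (a b : R) : a < b -> at_right a (fun x => a < x < b).
Proof.
intros H.
exists (mkposreal (b - a) (Rlt_Rminus _ _ H)); intros y Hy Hay.
unfold ball in Hy; simpl in Hy; unfold AbsRing_ball, abs, minus, plus, opp in Hy; simpl in Hy.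
apply Rabs_lt_between in Hy; lra.
Qed.

Lemma at_left_between (a b : R) : a < b -> at_left b (fun x => a < x < b).
Proof.
intros H.
exists (mkposreal (b - a) (Rlt_Rminus _ _ H)); intros y Hy Hay.
unfold ball in Hy; simpl in Hy; unfold AbsRing_ball, abs, minus, plus, opp in Hy; simpl in Hy.
apply Rabs_lt_between in Hy; lra.
Qed.

Lemma locally_between (a b x : R) : a < x < b -> locally x (fun y => a < y < b).
Proof.
intros H; apply (open_and (fun y => a < y) (fun y => y < b)).
- apply open_gt.
- apply open_lt.
- exact H.
Qed.

Definition primitive01 (f G : R -> R) : Prop :=
  forall x, 0 < x < 1 -> is_derive G x (f x) /\ continuous f x.

(** Integrability is recorded through a primitive with limits at both ends. Linearity, positivity,
    vanishing of boundary terms and cutting at an interior point then become statements on that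
    primitive. For integrands continuous on (0,1) this agrees with [is_RInt_gen]. *)
Definition improper01 (f : R -> R) (l : R) : Prop :=
  exists (G : R -> R) (la lb : R), primitive01 f G /\
    filterlim G (at_right 0) (locally la) /\
    filterlim G (at_left 1) (locally lb) /\ l = lb - la.

Lemma primitive01_RInt f G u v : primitive01 f G -> 0 < u < 1 -> 0 < v < 1 ->
  is_RInt f u v (G v - G u).
Proof.
intros H Hu Hv.
assert (B : forall x, Rmin u v <= x <= Rmax u v -> 0 < x < 1).
{ intros x; unfold Rmin, Rmax; destruct (Rle_dec u v); lra. }
apply (is_RInt_derive G f); intros x Hx; apply H, B, Hx.
Qed.

(** The filters are arbitrary so that the lemma serves both for (0,1) and for the two pieces cut off
    at an interior point. *)
Lemma primitive01_RInt_gen f G (Fa Fb : (R -> Prop) -> Prop)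
  {FFa : Filter Fa} {FFb : Filter Fb} la lb :
  primitive01 f G -> Fa (fun x => 0 < x < 1) -> Fb (fun x => 0 < x < 1) ->
  filterlim G Fa (locally la) -> filterlim G Fb (locally lb) ->
  is_RInt_gen f Fa Fb (lb - la).
Proof.
intros H HFa HFb La Lb.
apply (filterlimi_lim_ext_loc (fun ab => G (snd ab) - G (fst ab))).
- apply (Filter_prod _ _ _ _ _ HFa HFb); intros; now apply primitive01_RInt.
- apply (filterlim_comp_2 (G := locally lb) (H := locally (- la))
    (fun ab => G (snd ab)) (fun ab => - G (fst ab)) Rplus).
  + exact (filterlim_comp _ _ _ snd G _ _ _ filterlim_snd Lb).
  + apply (filterlim_comp _ _ _ (fun ab => G (fst ab)) Ropp _ (locally la)).
    * exact (filterlim_comp _ _ _ fst G _ _ _ filterlim_fst La).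
    * apply (@filterlim_opp R_AbsRing R_NormedModule la).
  + apply (@filterlim_plus R_AbsRing R_NormedModule lb (- la)).
Qed.

Lemma primitive01_exists f : (forall x, 0 < x < 1 -> continuous f x) ->
  primitive01 f (RInt f (1 / 2)).
Proof.
intros Hf x Hx; split; [|now apply Hf].
apply (is_derive_RInt f (RInt f (1 / 2)) (1 / 2)); [|now apply Hf].
apply (filter_imp (fun y => 0 < y < 1)); [|now apply locally_between].
intros y Hy; apply (@RInt_correct R_CompleteNormedModule), (@ex_RInt_continuous R_CompleteNormedModule).
intros t; unfold Rmin, Rmax; destruct (Rle_dec (1 / 2) y); intros; apply Hf; lra.
Qed.

(** The hypothesis is a joint limit of G v - G u in both endpoints; the point is to extract a
    separate limit of [G] at each end. *)
Lemma improper01_of_RInt_gen f l : (forall x, 0 < x < 1 -> continuous f x) ->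
  is_RInt_gen f (at_right 0) (at_left 1) l -> improper01 f l.
Proof.
intros Hf Hl.
set (G := RInt f (1 / 2)); assert (HG : primitive01 f G) by now apply primitive01_exists.
assert (HI := proj1 (filterlimi_locally _ _) Hl).
assert (in0 := at_right_between 0 1 Rlt_0_1); assert (in1 := at_left_between 0 1 Rlt_0_1).
assert (near : forall u v y, 0 < u < 1 -> 0 < v < 1 -> is_RInt f u v y -> y = G v - G u).
{ intros u v y Hu Hv Hy.
  rewrite <- (is_RInt_unique _ _ _ _ Hy); apply is_RInt_unique; now apply primitive01_RInt. }
(* Cauchy criterion: with one common [v] near 1, both G v - G u and G v - G u' lie within eps/2 of
   [l], so G u and G u' differ by less than eps. The limit at 1 is symmetric. *)
assert (La : exists la, filterlim G (at_right 0) (locally la)).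
{ apply (filterlim_locally_cauchy (U := R_CompleteSpace)); intros eps.
  destruct (HI (pos_div_2 eps)) as [Q1 Q2 H1 H2 H12].
  exists (fun u => Q1 u /\ 0 < u < 1); split; [now apply filter_and|].
  destruct (filter_ex _ (filter_and _ _ H2 in1)) as [v [Hv Hv']].
  intros u u' [Hu Iu] [Hu' Iu'].
  destruct (H12 u v Hu Hv) as [y [Hy By]]; destruct (H12 u' v Hu' Hv) as [y' [Hy' By']].
  simpl in *; apply near in Hy; trivial; apply near in Hy'; trivial.
  unfold ball in *; simpl in *; unfold AbsRing_ball, abs, minus, plus, opp in *; simpl in *.
  apply Rabs_lt_between in By; apply Rabs_lt_between in By'; apply Rabs_lt_between; lra. }
assert (Lb : exists lb, filterlim G (at_left 1) (locally lb)).
{ apply (filterlim_locally_cauchy (U := R_CompleteSpace)); intros eps.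
  destruct (HI (pos_div_2 eps)) as [Q1 Q2 H1 H2 H12].
  exists (fun u => Q2 u /\ 0 < u < 1); split; [now apply filter_and|].
  destruct (filter_ex _ (filter_and _ _ H1 in0)) as [u [Hu Iu]].
  intros v v' [Hv Iv] [Hv' Iv'].
  destruct (H12 u v Hu Hv) as [y [Hy By]]; destruct (H12 u v' Hu Hv') as [y' [Hy' By']].
  simpl in *; apply near in Hy; trivial; apply near in Hy'; trivial.
  unfold ball in *; simpl in *; unfold AbsRing_ball, abs, minus, plus, opp in *; simpl in *.
  apply Rabs_lt_between in By; apply Rabs_lt_between in By'; apply Rabs_lt_between; lra. }
destruct La as [la La]; destruct Lb as [lb Lb].
exists G, la, lb; repeat split; trivial; try apply HG; trivial.
rewrite <- (is_RInt_gen_unique (V := R_CompleteNormedModule) _ _ Hl).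
apply (is_RInt_gen_unique (V := R_CompleteNormedModule)).
apply (primitive01_RInt_gen f G); trivial; typeclasses eauto.
Qed.

Lemma improper01_ext f g l : (forall x, 0 < x < 1 -> f x = g x) ->
  improper01 f l -> improper01 g l.
Proof.
intros E [G [la [lb [HG H]]]]; exists G, la, lb; split; [|exact H].
intros x Hx; destruct (HG x Hx) as [D Cf]; split; [now rewrite <- E|].
apply (continuous_ext_loc _ f); [|exact Cf].
apply (filter_imp (fun y => 0 < y < 1)); [|now apply locally_between].
exact E.
Qed.

Lemma improper01_RInt_gen f l : improper01 f l -> RInt_gen f (at_right 0) (at_left 1) = l.
Proof.
intros [G [la [lb [HG [La [Lb ->]]]]]].
apply (is_RInt_gen_unique (V := R_CompleteNormedModule)).
apply (primitive01_RInt_gen f G); trivial; try typeclasses eauto;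
  [apply at_right_between | apply at_left_between]; lra.
Qed.

Lemma improper01_unique f k l : improper01 f k -> improper01 f l -> k = l.
Proof.
intros Hk Hl; now rewrite <- (improper01_RInt_gen f k), (improper01_RInt_gen f l).
Qed.

Lemma filterlim_lin (F : (R -> Prop) -> Prop) {FF : Filter F} f g a b c :
  filterlim f F (locally a) -> filterlim g F (locally b) ->
  filterlim (fun x => f x + c * g x) F (locally (a + c * b)).
Proof.
intros Hf Hg.
apply (filterlim_comp_2 (G := locally a) (H := locally (c * b)) f (fun x => c * g x) Rplus);
  trivial.
- apply (filterlim_comp _ _ _ g (Rmult c) _ _ _ Hg).
  apply (@filterlim_scal_r R_AbsRing R_NormedModule c b).
- apply (@filterlim_plus R_AbsRing R_NormedModule a (c * b)).
Qed.

Lemma improper01_lin f g k l c : improper01 f k -> improper01 g l ->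
  improper01 (fun x => f x + c * g x) (k + c * l).
Proof.
intros [G [ga [gb [HG [Ga [Gb ->]]]]]] [H [ha [hb [HH [Ha [Hb ->]]]]]].
exists (fun x => G x + c * H x), (ga + c * ha), (gb + c * hb).
split; [|split; [|split]].
- intros x Hx; destruct (HG x Hx) as [DG Cf]; destruct (HH x Hx) as [DH Cg]; split.
  + apply (@is_derive_plus R_AbsRing R_NormedModule G (fun x => c * H x)); [exact DG|].
    now apply is_derive_scal.
  + apply (continuous_plus (V := R_NormedModule) f); [exact Cf|].
    now apply (continuous_scal_r (V := R_NormedModule) c g).
- apply filterlim_lin; trivial; typeclasses eauto.
- apply filterlim_lin; trivial; typeclasses eauto.
- ring.
Qed.

(** A primitive [G] is nondecreasing, and strictly increases across a neighbourhood of [x0] on which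
    [f] is positive by continuity. Its limits at the two ends therefore differ. *)
Lemma improper01_pos f l x0 : (forall x, 0 < x < 1 -> 0 <= f x) -> 0 < x0 < 1 -> 0 < f x0 ->
  improper01 f l -> 0 < l.
Proof.
intros Pf Hx0 Px0 [G [la [lb [HG [La [Lb ->]]]]]].
assert (mono : forall u v, 0 < u -> u <= v -> v < 1 -> G u <= G v).
{ intros u v Hu [Huv| ->] Hv; [|lra].
  assert (0 <= G v - G u); [|lra].
  apply (is_RInt_ge_0 f u v); [lra | apply primitive01_RInt; trivial; lra |].
  intros; apply Pf; lra. }
assert (HD : exists x1 x2, 0 < x1 /\ x1 < x2 < 1 /\ G x1 < G x2).
{ assert (N : locally x0 (fun x => 0 < x < 1 /\ 0 < f x)).
  { apply filter_and; [now apply locally_between|].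
    apply (proj2 (HG x0 Hx0)); now apply (open_gt 0). }
  destruct N as [d Hd].
  (* Half the radius keeps the closed interval inside the open ball. *)
  assert (Hin : forall x, x0 - d / 2 <= x <= x0 + d / 2 -> 0 < x < 1 /\ 0 < f x).
  { intros x Hx; apply Hd; unfold ball; simpl; unfold AbsRing_ball, abs, minus, plus, opp; simpl.
    destruct d as [d Pd]; simpl in *; apply Rabs_lt_between; lra. }
  destruct d as [d Pd]; simpl in *.
  exists (x0 - d / 2), (x0 + d / 2).
  destruct (Hin (x0 - d / 2)) as [[H1 H2] _]; [lra|].
  destruct (Hin (x0 + d / 2)) as [[H3 H4] _]; [lra|].
  repeat split; try lra.
  assert (0 < G (x0 + d / 2) - G (x0 - d / 2)); [|lra].
  rewrite <- (is_RInt_unique f (x0 - d/2) (x0 + d/2) (G (x0 + d / 2) - G (x0 - d / 2))).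
  - apply RInt_gt_0; [lra| |]; intros x Hx; [apply Hin; lra|].
    apply HG, Hin; lra.
  - apply primitive01_RInt; trivial; lra. }
destruct HD as [x1 [x2 [H1 [[H12 H2] HD]]]].
assert (la <= G x1).
{ apply (filterlim_le (F := at_right 0) G (fun _ => G x1) la (G x1)).
  - apply (filter_imp (fun x => 0 < x < x1)); [|now apply at_right_between].
    intros x Hx; apply mono; lra.
  - exact La.
  - apply filterlim_const. }
assert (G x2 <= lb).
{ apply (filterlim_le (F := at_left 1) (fun _ => G x2) G (G x2) lb).
  - apply (filter_imp (fun x => x2 < x < 1)); [|now apply at_left_between].
    intros x Hx; apply mono; lra.
  - apply filterlim_const.
  - exact Lb. }
lra.
Qed.

(** * The weight *)

Lemma Rpower_at_right_0 (s : R) : 0 < s -> filterlim (fun x => Rpower x s) (at_right 0) (locally 0).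
Proof.
intros Hs.
apply (filterlim_comp _ _ _ (fun x => s * ln x) exp _ (Rbar_locally m_infty)).
- apply (filterlim_comp _ _ _ ln (Rmult s) _ (Rbar_locally m_infty)).
  + apply is_lim_ln_0.
  + intros Q [M HM]; exists (M / s); intros x Hx; apply HM.
    apply (Rmult_lt_compat_l s) in Hx; trivial.
    replace (s * (M / s)) with M in Hx by (field; lra); exact Hx.
- apply is_lim_exp_m.
Qed.

Lemma filterlim_mult_bounded (F : (R -> Prop) -> Prop) {FF : Filter F} (f g : R -> R) :
  filterlim f F (locally 0) -> (exists M, F (fun x => Rabs (g x) <= M)) ->
  filterlim (fun x => f x * g x) F (locally 0).
Proof.
intros Hf [M HM]; apply filterlim_locally; intros [eps He].
(* [M] itself may be 0, and the bound is used as a divisor. *)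
assert (HM' : 0 < Rmax M 1) by (apply Rlt_le_trans with (2 := Rmax_r M 1); lra).
assert (H := proj1 (filterlim_locally _ _) Hf (mkposreal (eps / Rmax M 1) (Rdiv_lt_0_compat _ _ He HM'))).
apply (filter_imp (fun x => ball 0 (eps / Rmax M 1) (f x) /\ Rabs (g x) <= M));
  [|now apply filter_and].
intros x [Hfx Hgx]; unfold ball in *; simpl in *; unfold AbsRing_ball, abs, minus, plus, opp in *.
simpl in *; rewrite Ropp_0, Rplus_0_r in *; rewrite Rabs_mult.
assert (Hg2 : Rabs (g x) <= Rmax M 1) by (apply Rle_trans with (1 := Hgx), Rmax_l).
apply Rle_lt_trans with (Rabs (f x) * Rmax M 1).
- apply Rmult_le_compat_l; trivial; apply Rabs_pos.
- apply (Rmult_lt_compat_r (Rmax M 1)) in Hfx; trivial.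
  replace (eps / Rmax M 1 * Rmax M 1) with eps in Hfx by (field; lra); exact Hfx.
Qed.

Lemma continuous_at_right (f : R -> R) (x : R) : continuous f x ->
  filterlim f (at_right x) (locally (f x)).
Proof. intros H; apply filterlim_filter_le_1 with (2 := H), filter_le_within. Qed.

(** The factor x of x - x^2 turns x^a into x^(a+1), which tends to 0 because a > -1; the other
    factors stay bounded near 0. *)
Lemma weight_at_right_0 (a b : R) (w0 r : R -> R) : -1 < a ->
  (exists M, at_right 0 (fun x => Rabs (w0 x) <= M)) -> continuous r 0 ->
  filterlim (fun x => (x - x ^ 2) * r x * weight a b w0 x) (at_right 0) (locally 0).
Proof.
intros Ha HM Hr.
set (k := fun x => (1 - x) * Rpower (1 - x) b * r x).
apply (filterlim_ext_loc (fun x => Rpower x (a + 1) * k x * w0 x)).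
- apply (filter_imp (fun x => 0 < x < 1)); [|apply at_right_between; lra].
  intros x Hx; unfold k, weight; rewrite Rpower_plus, Rpower_1 by lra; ring.
- apply filterlim_mult_bounded; [typeclasses eauto| |exact HM].
  replace 0 with (0 * k 0) at 2 by ring.
  apply (filterlim_comp_2 (G := locally 0) (H := locally (k 0)) (fun x => Rpower x (a + 1)) k Rmult).
  + apply Rpower_at_right_0; lra.
  + apply continuous_at_right; unfold k.
    apply (continuous_mult (K := R_AbsRing) (fun x => (1 - x) * Rpower (1 - x) b)); trivial.
    apply (ex_derive_continuous (K := R_AbsRing) (V := R_NormedModule)).
    unfold Rpower; auto_derive; lra.
  + apply (@filterlim_mult R_AbsRing 0 (k 0)).
Qed.

(** The reflection x -> 1 - x exchanges the exponents and reduces the claim to the endpoint 0. *)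
Lemma weight_at_left_1 (a b : R) (w0 r : R -> R) : -1 < b ->
  (exists M, at_left 1 (fun x => Rabs (w0 x) <= M)) -> continuous r 1 ->
  filterlim (fun x => (x - x ^ 2) * r x * weight a b w0 x) (at_left 1) (locally 0).
Proof.
intros Hb [M HM] Hr.
assert (flip_l : filterlim (fun x => 1 - x) (at_left 1) (at_right 0)).
{ intros Q [d Hd]; exists d; intros y Hy Hy1; apply Hd; [|lra].
  revert Hy; unfold ball; simpl; unfold AbsRing_ball, abs, minus, plus, opp; simpl.
  intros Hy; rewrite <- Rabs_Ropp; replace (- (1 - y + - 0)) with (y + - (1)) by ring; exact Hy. }
assert (flip_r : filterlim (fun x => 1 - x) (at_right 0) (at_left 1)).
{ intros Q [d Hd]; exists d; intros y Hy Hy1; apply Hd; [|lra].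
  revert Hy; unfold ball; simpl; unfold AbsRing_ball, abs, minus, plus, opp; simpl.
  intros Hy; rewrite <- Rabs_Ropp; replace (- (1 - y + - (1))) with (y + - 0) by ring; exact Hy. }
apply (filterlim_ext (fun x => (1 - x - (1 - x) ^ 2) * r (1 - (1 - x)) *
         weight b a (fun y => w0 (1 - y)) (1 - x))).
- intros x; unfold weight; replace (1 - (1 - x)) with x by ring; ring.
- apply (filterlim_comp _ _ _ (fun x => 1 - x)
    (fun y => (y - y ^ 2) * r (1 - y) * weight b a (fun y => w0 (1 - y)) y) _ _ _ flip_l).
  apply (weight_at_right_0 b a (fun y => w0 (1 - y)) (fun y => r (1 - y)) Hb).
  + exists M; apply (flip_r _ HM).
  + apply continuous_comp; [|now replace (1 - 0) with 1 by ring].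
    apply (ex_derive_continuous (K := R_AbsRing) (V := R_NormedModule)); auto_derive; trivial.
Qed.

Section JacobiWeight.
Context (a b : R) (w0 : R -> R) (Hw0 : jacobi_type a b w0).

Lemma weight_pos x : 0 < x < 1 -> 0 < weight a b w0 x.
Proof.
intros Hx; unfold weight, Rpower.
repeat apply Rmult_lt_0_compat; try apply exp_pos; now apply (jacobi_pos _ _ _ Hw0).
Qed.

Definition Dweight x := weight a b w0 x * (a / x - b / (1 - x)) +
  Rpower x a * Rpower (1 - x) b * Derive w0 x.

Lemma is_derive_weight x : 0 < x < 1 -> is_derive (weight a b w0) x (Dweight x).
Proof.
intros Hx; assert (H := jacobi_derivable _ _ _ Hw0 x Hx).
unfold weight, Dweight, weight, Rpower; auto_derive; [repeat split; trivial; lra|].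
change (Derive (fun y => w0 y) x) with (Derive w0 x); replace (1 + - x) with (1 - x) by ring.
field; lra.
Qed.

Lemma continuous_Dweight x : 0 < x < 1 -> continuous Dweight x.
Proof.
intros Hx; unfold Dweight.
apply (continuous_plus (V := R_NormedModule)); apply (continuous_mult (K := R_AbsRing)).
- apply (ex_derive_continuous (K := R_AbsRing) (V := R_NormedModule)).
  eexists; now apply is_derive_weight.
- apply (ex_derive_continuous (K := R_AbsRing) (V := R_NormedModule)).
  auto_derive; lra.
- apply (ex_derive_continuous (K := R_AbsRing) (V := R_NormedModule)).
  unfold Rpower; auto_derive; lra.
- now apply (jacobi_C1 _ _ _ Hw0).
Qed.

Lemma continuous_weight x : 0 < x < 1 -> continuous (weight a b w0) x.
Proof.
intros Hx; apply (ex_derive_continuous (K := R_AbsRing) (V := R_NormedModule)).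
eexists; now apply is_derive_weight.
Qed.

(** From v = - ln w follows v' w = - w', which makes the kernel integrand accessible to integration
    by parts. *)
Lemma Derive_potential x : 0 < x < 1 ->
  weight a b w0 x * Derive (potential (weight a b w0)) x = - Dweight x.
Proof.
intros Hx; assert (H := weight_pos x Hx).
rewrite (is_derive_unique _ _ (- (Dweight x / weight a b w0 x))); [field; lra|].
apply (@is_derive_opp R_AbsRing R_NormedModule).
assert (D := is_derive_weight x Hx).
evar_last; [apply (is_derive_comp ln _ x _ _ (is_derive_ln _ H) D)|].
unfold scal; simpl; unfold mult; simpl; field; lra.
Qed.

(* Integration by parts: the boundary terms vanish because the exponents exceed [-1]. *)
Lemma improper01_parts (r r' : R -> R) (l : R) (ha : -1 < a) (hb : -1 < b) :
  (forall x, is_derive r x (r' x)) -> (forall x, continuous r' x) ->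
  improper01 (fun x => ((1 - 2 * x) * r x + (x - x ^ 2) * r' x) * weight a b w0 x) l ->
  improper01 (fun x => (x - x ^ 2) * r x * Dweight x) (- l).
Proof.
intros Dr Cr' Hl.
assert (Cr : forall x, continuous r x).
{ intros x; apply (ex_derive_continuous (K := R_AbsRing) (V := R_NormedModule)).
  eexists; apply Dr. }
(* This integrand is the derivative of (x - x^2) r w, so its integral is 0. Subtracting the part
   known to converge leaves the integral with [Dweight], whose convergence is thus a conclusion. *)
assert (H : improper01 (fun x => ((1 - 2 * x) * r x + (x - x ^ 2) * r' x) * weight a b w0 x
   + (x - x ^ 2) * r x * Dweight x) 0).
{ exists (fun x => (x - x ^ 2) * r x * weight a b w0 x), 0, 0; split; [|split; [|split]].
  - intros x Hx; split.
    + assert (D := is_derive_weight x Hx); specialize (Dr x).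
      apply (is_derive_ext (fun x => ((x - x ^ 2) * r x) * weight a b w0 x)); [easy|].
      evar_last; [apply (Derive.is_derive_mult (fun x => (x - x ^ 2) * r x)); [|exact D]|].
      * apply (Derive.is_derive_mult (fun x => x - x ^ 2)); [|exact Dr].
        instantiate (1 := 1 - 2 * x); auto_derive; [easy | ring].
      * ring.
    + apply (continuous_plus (V := R_NormedModule)); apply (continuous_mult (K := R_AbsRing)).
      * apply (continuous_plus (V := R_NormedModule)); apply (continuous_mult (K := R_AbsRing)); trivial;
        apply (ex_derive_continuous (K := R_AbsRing) (V := R_NormedModule)); auto_derive; trivial.
      * now apply continuous_weight.
      * apply (continuous_mult (K := R_AbsRing)); trivial;
        apply (ex_derive_continuous (K := R_AbsRing) (V := R_NormedModule)); auto_derive; trivial.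
      * now apply continuous_Dweight.
  - apply weight_at_right_0; trivial; apply (jacobi_bounded_0 _ _ _ Hw0).
  - apply weight_at_left_1; trivial; apply (jacobi_bounded_1 _ _ _ Hw0).
  - ring. }
replace (- l) with (0 + -1 * l) by ring.
apply (improper01_ext (fun x => (((1 - 2 * x) * r x + (x - x ^ 2) * r' x) * weight a b w0 x
   + (x - x ^ 2) * r x * Dweight x) + -1 * (((1 - 2 * x) * r x + (x - x ^ 2) * r' x) * weight a b w0 x))).
- intros; ring.
- now apply improper01_lin.
Qed.

End JacobiWeight.

(** * Integrals split at [z] *)

(** [ex_int01] and [int01] merged into one relation, so that convergence and value travel together.
    It is stated for real functions; [is_int01] applies it to real and imaginary parts. *)
Definition split_RInt (z : C) (f : R -> R) (v : R) : Prop :=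
  (in_open01 z -> exists v1 v2,
     is_RInt_gen f (at_right 0) (at_left (Re z)) v1 /\
     is_RInt_gen f (at_right (Re z)) (at_left 1) v2 /\ v = v1 + v2) /\
  (~ in_open01 z -> is_RInt_gen f (at_right 0) (at_left 1) v).

Definition is_int01 (z : C) (f : R -> C) (v : C) : Prop :=
  split_RInt z (fun x => Re (f x)) (Re v) /\ split_RInt z (fun x => Im (f x)) (Im v).

Lemma is_RInt_gen_ext_between (u v : R) (f g : R -> R) (l : R) : u < v ->
  (forall x, u < x < v -> f x = g x) ->
  is_RInt_gen f (at_right u) (at_left v) l -> is_RInt_gen g (at_right u) (at_left v) l.
Proof.
intros Huv E; apply is_RInt_gen_ext; [typeclasses eauto..|].
apply (Filter_prod _ _ _ _ _ (at_right_between u v Huv) (at_left_between u v Huv)).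
intros s t Hs Ht x; simpl; unfold Rmin, Rmax; destruct (Rle_dec s t); intros; apply E; lra.
Qed.

Lemma is_RInt_gen_lin (F G : (R -> Prop) -> Prop) {FF : Filter F} {FG : Filter G}
  (f g : R -> R) k l c :
  is_RInt_gen f F G k -> is_RInt_gen g F G l ->
  is_RInt_gen (fun x => f x + c * g x) F G (k + c * l).
Proof.
intros Hf Hg.
apply (is_RInt_gen_plus (V := R_NormedModule) f (fun x => c * g x)); trivial.
now apply (is_RInt_gen_scal (V := R_NormedModule) g c).
Qed.

Lemma in_open01_Re z : in_open01 z -> 0 < Re z < 1.
Proof. now intros [x [Hx ->]]. Qed.

(** The one-sided integrals never evaluate the integrand at [z], so the functions may differ there;
    this is where the kernel has its denominator 0. *)
Lemma split_RInt_ext z f g v : (forall x, 0 < x < 1 -> RtoC x <> z -> f x = g x) ->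
  split_RInt z f v -> split_RInt z g v.
Proof.
intros E [H1 H2]; split; intros Hz.
- assert (Hx := in_open01_Re z Hz); destruct (H1 Hz) as [v1 [v2 [I1 [I2 ->]]]].
  exists v1, v2; split; [|split]; trivial.
  + apply is_RInt_gen_ext_between with (3 := I1); [lra|]; intros x I; apply E; [lra|].
    intros <-; simpl in I; lra.
  + apply is_RInt_gen_ext_between with (3 := I2); [lra|]; intros x I; apply E; [lra|].
    intros <-; simpl in I; lra.
- apply is_RInt_gen_ext_between with (3 := H2 Hz); [lra|]; intros x I; apply E; trivial.
  intros <-; apply Hz; now exists x.
Qed.

Lemma split_RInt_lin z f g k l c : split_RInt z f k -> split_RInt z g l ->
  split_RInt z (fun x => f x + c * g x) (k + c * l).
Proof.
intros [F1 F2] [G1 G2]; split; intros Hz.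
- destruct (F1 Hz) as [k1 [k2 [I1 [I2 ->]]]]; destruct (G1 Hz) as [l1 [l2 [J1 [J2 ->]]]].
  exists (k1 + c * l1), (k2 + c * l2); split; [|split]; [| |ring];
    apply is_RInt_gen_lin; trivial; typeclasses eauto.
- apply is_RInt_gen_lin; [typeclasses eauto..| |]; auto.
Qed.

Lemma split_RInt_unique z f k l : split_RInt z f k -> split_RInt z f l -> k = l.
Proof.
assert (U : forall u v (g : R -> R) (k' l' : R), is_RInt_gen g (at_right u) (at_left v) k' ->
   is_RInt_gen g (at_right u) (at_left v) l' -> k' = l').
{ intros u v g k' l' Hk Hl.
  rewrite <- (is_RInt_gen_unique (V := R_CompleteNormedModule) _ _ Hk).
  now apply (is_RInt_gen_unique (V := R_CompleteNormedModule)). }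
intros [F1 F2] [G1 G2]; destruct (Classical_Prop.classic (in_open01 z)) as [Hz|Hz].
- destruct (F1 Hz) as [k1 [k2 [I1 [I2 ->]]]]; destruct (G1 Hz) as [l1 [l2 [J1 [J2 ->]]]].
  now rewrite (U _ _ _ _ _ I1 J1), (U _ _ _ _ _ I2 J2).
- exact (U _ _ _ _ _ (F2 Hz) (G2 Hz)).
Qed.

(** For z in (0,1) the primitive is continuous at z, so its value there is the missing one-sided
    limit of both pieces and cancels in the sum. *)
Lemma split_RInt_improper z f l : improper01 f l -> split_RInt z f l.
Proof.
intros [G [la [lb [HG [La [Lb ->]]]]]].
assert (in0 := at_right_between 0 1 Rlt_0_1); assert (in1 := at_left_between 0 1 Rlt_0_1).
split; intros Hz.
- assert (Hx := in_open01_Re z Hz).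
  assert (CG : continuous G (Re z)).
  { apply (ex_derive_continuous (K := R_AbsRing) (V := R_NormedModule)).
    eexists; now apply HG. }
  exists (G (Re z) - la), (lb - G (Re z)); split; [|split]; [| |ring];
    apply primitive01_RInt_gen with G; trivial; try typeclasses eauto.
  + apply (filter_imp (fun x => 0 < x < Re z)); [intros; lra|apply at_left_between; lra].
  + apply filterlim_filter_le_1 with (2 := CG), filter_le_within.
  + apply (filter_imp (fun x => Re z < x < 1)); [intros; lra|apply at_right_between; lra].
  + apply filterlim_filter_le_1 with (2 := CG), filter_le_within.
- apply primitive01_RInt_gen with G; trivial; typeclasses eauto.
Qed.

Lemma is_RInt_gen_components (F G : (R -> Prop) -> Prop) {FF : Filter F} {FG : Filter G}
  (f : R -> C) (l : C) : @is_RInt_gen C_R_NormedModule f F G l ->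
  is_RInt_gen (fun x => Re (f x)) F G (Re l) /\ is_RInt_gen (fun x => Im (f x)) F G (Im l).
Proof.
intros H; assert (HE := proj1 (filterlimi_locally _ _) H); split;
  apply filterlimi_locally; intros eps; generalize (HE eps); apply filter_imp;
  intros [u v] [y [Hy [B1 B2]]].
- exists (Re y); split; [|exact B1].
  exact (@is_RInt_fct_extend_fst R_NormedModule R_NormedModule f u v y Hy).
- exists (Im y); split; [|exact B2].
  exact (@is_RInt_fct_extend_snd R_NormedModule R_NormedModule f u v y Hy).
Qed.

Lemma is_int01_correct z f : ex_int01 f z -> is_int01 z f (int01 f z).
Proof.
intros [H1 H2]; unfold int01.
destruct (ClassicalEpsilon.excluded_middle_informative (in_open01 z)) as [Hz|Hz].
- destruct (H1 Hz) as [E1 E2].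
  destruct (is_RInt_gen_components _ _ f _
    (RInt_gen_correct (V := C_R_CompleteNormedModule) f E1)) as [R1 I1].
  destruct (is_RInt_gen_components _ _ f _
    (RInt_gen_correct (V := C_R_CompleteNormedModule) f E2)) as [R2 I2].
  split; (split; [intros _|easy]); do 2 eexists;
    (split; [eassumption | split; [eassumption | reflexivity]]).
- destruct (is_RInt_gen_components _ _ f _
    (RInt_gen_correct (V := C_R_CompleteNormedModule) f (H2 Hz))) as [R1 I1].
  split; (split; [easy|intros _]); assumption.
Qed.

Lemma is_int01_unique z f k l : is_int01 z f k -> is_int01 z f l -> k = l.
Proof.
intros [R1 I1] [R2 I2]; apply injective_projections.
- exact (split_RInt_unique _ _ _ _ R1 R2).
- exact (split_RInt_unique _ _ _ _ I1 I2).
Qed.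

Lemma is_int01_ext z f g v : (forall x, 0 < x < 1 -> RtoC x <> z -> f x = g x) ->
  is_int01 z f v -> is_int01 z g v.
Proof.
intros E [H1 H2]; split.
- apply split_RInt_ext with (2 := H1); intros x Hx Hz; now rewrite E.
- apply split_RInt_ext with (2 := H2); intros x Hx Hz; now rewrite E.
Qed.

Lemma is_int01_lin z f g k l c : is_int01 z f k -> is_int01 z g l ->
  is_int01 z (fun x => (f x + c * g x)%C) (k + c * l)%C.
Proof.
intros [F1 F2] [G1 G2]; split.
- replace (Re (k + c * l)%C) with (Re k + Re c * Re l + - Im c * Im l)
    by (unfold Re, Im, Cplus, Cmult; simpl; ring).
  apply (split_RInt_ext z (fun x => Re (f x) + Re c * Re (g x) + - Im c * Im (g x))).
  + intros; unfold Re, Im, Cplus, Cmult; simpl; ring.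
  + apply split_RInt_lin; trivial; now apply split_RInt_lin.
- replace (Im (k + c * l)%C) with (Im k + Re c * Im l + Im c * Re l)
    by (unfold Re, Im, Cplus, Cmult; simpl; ring).
  apply (split_RInt_ext z (fun x => Im (f x) + Re c * Im (g x) + Im c * Re (g x))).
  + intros; unfold Re, Im, Cplus, Cmult; simpl; ring.
  + apply split_RInt_lin; trivial; now apply split_RInt_lin.
Qed.

Lemma improper01_0 : improper01 (fun _ => 0) 0.
Proof.
exists (fun _ => 0), 0, 0; split; [|split; [|split]].
- intros x _; split; [apply (is_derive_const (V := R_NormedModule))|apply continuous_const].
- apply filterlim_const.
- apply filterlim_const.
- ring.
Qed.

Lemma is_int01_RtoC z f l : improper01 f l -> is_int01 z (fun x => RtoC (f x)) (RtoC l).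
Proof.
intros H; split; apply split_RInt_improper; [exact H | exact improper01_0].
Qed.

(* Coquelicot equips [C] with two normed module structures over itself, whose norms agree but
   whose balls differ; the product rule is only available for the first one. *)
Lemma is_derive_C_AbsRing (f : C -> C) (z l : C) :
  @is_derive C_AbsRing (AbsRing_NormedModule C_AbsRing) f z l <->
  @is_derive C_AbsRing C_NormedModule f z l.
Proof.
split; intros [[Hp Hs Hn] Hd]; split.
- now split.
- exact Hd.
- now split.
- exact Hd.
Qed.

Lemma is_derive_C_mult (f g : C -> C) (z l m : C) :
  @is_derive C_AbsRing C_NormedModule f z l -> @is_derive C_AbsRing C_NormedModule g z m ->
  @is_derive C_AbsRing C_NormedModule (fun x => f x * g x)%C z (l * g z + f z * m)%C.
Proof.
intros Hf Hg; apply is_derive_C_AbsRing.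
apply (@is_derive_mult C_AbsRing f g); [now apply is_derive_C_AbsRing..|exact Cmult_comm].
Qed.

Lemma is_derive_C_id (z : C) : @is_derive C_AbsRing C_NormedModule (fun x => x) z (RtoC 1).
Proof. apply is_derive_C_AbsRing, (@is_derive_id C_AbsRing). Qed.

(** * The extended kernel integral *)

Module PolynomialMoments.
Import all_boot all_algebra Rstruct.
Import GRing.Theory.
Import OrthogonalPolynomials.
Local Open Scope R_scope.

(** * Evaluation of polynomials at real points *)

Definition peval (p : {poly R}) (x : R) : R := p.[x]%R.

Lemma peval_add p q x : peval (p + q)%R x = peval p x + peval q x.
Proof. exact: hornerD. Qed.

Lemma peval_mul p q x : peval (p * q)%R x = peval p x * peval q x.
Proof. exact: hornerM. Qed.

Lemma peval_const c x : peval c%:P%R x = c.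
Proof. exact: hornerC. Qed.

Lemma peval_X x : peval 'X%R x = x.
Proof. exact: hornerX. Qed.

Lemma sum_n_bigop (f : nat -> R) n : sum_n f n = (\sum_(i < n.+1) f i)%R.
Proof.
elim: n => [|n IH]; first by rewrite sum_O big_ord_recl big_ord0 addr0.
by rewrite sum_Sn IH [RHS]big_ord_recr.
Qed.

Definition pol (P : nat -> nat -> R) n : {poly R} := (\poly_(i < n.+1) P n i)%R.

Lemma peval_pol P n x : peval (pol P n) x = poly_R P n x.
Proof.
rewrite /peval /poly_R sum_n_bigop horner_poly.
by apply: eq_bigr => i _; rewrite -RpowE.
Qed.

Lemma is_derive_peval (p : {poly R}) x : is_derive (peval p) x (peval p^`()%R x).
Proof.
elim/poly_ind: p => [|p c IH].
  rewrite derivC; apply: (is_derive_ext (fun=> 0)) => [y|]; first by rewrite peval_const.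
  rewrite peval_const; exact: is_derive_const.
apply: (is_derive_ext (fun y => peval p y * y + c)) => [y|].
  by rewrite peval_add peval_mul peval_const peval_X.
rewrite derivMXaddC peval_add peval_mul peval_X.
evar_last.
  apply: (@is_derive_plus R_AbsRing R_NormedModule (fun y => peval p y * y)); last exact: is_derive_const.
  by apply: Derive.is_derive_mult; [exact: IH | exact: is_derive_id].
change (peval p^`()%R x * x + peval p x * 1 + 0 = peval p x + peval p^`()%R x * x); ring.
Qed.

Lemma continuous_peval (p : {poly R}) x : continuous (peval p) x.
Proof.
apply: (ex_derive_continuous (K := R_AbsRing) (V := R_NormedModule)).
by exists (peval p^`()%R x); apply: is_derive_peval.
Qed.

Lemma peval_neq0_01 (p : {poly R}) : p != 0%R -> exists x, 0 < x < 1 /\ peval p x <> 0.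
Proof.
(* The points 1/2, 1/3, ... are distinct and lie in (0,1); taking as many as the size of [p] gives
   more points than [p] can have roots. *)
move=> p0; pose rs := [seq / INR i.+2 | i <- iota 0 (size p)].
have urs : uniq rs.
  rewrite map_inj_uniq ?iota_uniq // => i j /(congr1 Rinv); rewrite !Rinv_inv.
  by move=> /INR_eq [].
have : ~~ all (root p) rs.
  apply/negP => ars; have := max_poly_roots p0 ars urs.
  by rewrite size_map size_iota ltnn.
case/allPn => x /mapP [i _ ->] /negP nr; exists (/ INR i.+2); split.
  have H : 1 < INR i.+2 by apply: (lt_INR 1); apply/ltP.
  split; first by apply: Rinv_0_lt_compat; lra.
  by rewrite -[X in _ < X]Rinv_1; apply: Rinv_lt_contravar; lra.
by move=> E; apply: nr; apply/eqP.
Qed.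

(** * Linear functionals given by their moments *)

Definition momR (m : nat -> R) (p : {poly R}) : R := (\sum_(i < size p) p`_i * m i)%R.

Lemma momR_widen m (p : {poly R}) n : (size p <= n)%N -> momR m p = (\sum_(i < n) p`_i * m i)%R.
Proof.
move=> pn; rewrite /momR (big_ord_widen n (fun i => p`_i * m i)%R pn) big_mkcond.
apply: eq_bigr => i _; case: ltnP => // ip; by rewrite nth_default ?mul0r.
Qed.

Lemma momR_add m p q : momR m (p + q)%R = momR m p + momR m q.
Proof.
pose n := maxn (size p) (size q).
rewrite (@momR_widen m (p + q)%R n) ?size_polyD // (@momR_widen m p n) ?leq_maxl //.
rewrite (@momR_widen m q n) ?leq_maxr // RplusE -big_split.
by apply: eq_bigr => i _; rewrite coefD mulrDl.
Qed.

Lemma momR_scal m a p : momR m (a%:P * p)%R = a * momR m p.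
Proof.
rewrite mul_polyC (@momR_widen m _ (size p)) ?size_scale_leq // RmultE mulr_sumr.
by apply: eq_bigr => i _; rewrite coefZ mulrA.
Qed.

Lemma momR_X m p : momR m ('X * p)%R = momR (fun k => m k.+1) p.
Proof.
rewrite (@momR_widen m _ (size p).+1); last first.
  by rewrite (leq_trans (size_polyMleq _ _)) // size_polyX.
rewrite big_ord_recl coefXM mul0r add0r.
by apply: eq_bigr => i _; rewrite coefXM.
Qed.

Lemma momR_const m c : momR m c%:P%R = c * m 0%N.
Proof.
by rewrite (@momR_widen m _ 1) ?size_polyC_leq1 // big_ord_recl big_ord0 addr0 coefC.
Qed.

(** Every linear functional is determined by its moments, so an identity between two of them has to
    be checked on monomials only. *)
Lemma momR_repr (f : {poly R} -> R) : (forall p q, f (p + q)%R = f p + f q) ->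
  (forall a p, f (a%:P * p)%R = a * f p) -> forall p, f p = momR (fun k => f 'X^k%R) p.
Proof.
move=> fD fZ p; rewrite /momR -{1}[p]coefK poly_def.
have f0 : f 0%R = 0 by have := fZ 0%R 0%R; rewrite mulr0 => ->; rewrite RmultE mul0r.
rewrite (big_morph f fD f0); apply: eq_bigr => i _.
by rewrite -mul_polyC fZ.
Qed.

(** The polynomials have real coefficients, so a complex valued functional is a pair of real
    ones. *)
Definition momC (m : nat -> C) (p : {poly R}) : C :=
  (momR (fun k => Re (m k)) p, momR (fun k => Im (m k)) p).

Lemma momC_add m p q : momC m (p + q)%R = (momC m p + momC m q)%C.
Proof. by rewrite /momC !momR_add. Qed.

Lemma momC_scal m a p : momC m (a%:P * p)%R = (RtoC a * momC m p)%C.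
Proof. by rewrite /momC !momR_scal /Cmult /=; congr pair; ring_simplify. Qed.

Lemma momC_const m c : momC m c%:P%R = (RtoC c * m 0%N)%C.
Proof. by rewrite /momC !momR_const /Cmult /=; congr pair; ring_simplify. Qed.

Lemma momC_0 m : momC m 0%R = RtoC 0.
Proof. by rewrite -[0%R : {poly R}]/(0%:P)%R momC_const; exact: Cmult_0_l. Qed.

Lemma momC_Xn m k : momC m 'X^k%R = m k.
Proof.
have H (m' : nat -> R) : momR m' 'X^k%R = m' k.
  elim: k m' => [|k IH] m'; last by rewrite exprS momR_X IH.
  by rewrite expr0 -[1%R]/(1%:P)%R momR_const Rmult_1_l.
by rewrite /momC !H; case: (m k).
Qed.

Lemma momC_X m p : momC m ('X * p)%R = momC (fun k => m k.+1) p.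
Proof. by rewrite /momC !momR_X. Qed.

Lemma momC_ext m1 m2 p : (forall k, m1 k = m2 k) -> momC m1 p = momC m2 p.
Proof. by move=> E; congr pair; apply: eq_bigr => i _; rewrite E. Qed.

Lemma momC_repr (f : {poly R} -> C) : (forall p q, f (p + q)%R = f p + f q)%C ->
  (forall a p, f (a%:P * p)%R = RtoC a * f p)%C -> forall p, f p = momC (fun k => f 'X^k%R) p.
Proof.
move=> fD fZ p; rewrite /momC.
rewrite -(@momR_repr (fun p => Re (f p))) => [|q r|a q]; first last.
  by rewrite fZ /Re /=; ring.
  by rewrite fD.
rewrite -(@momR_repr (fun p => Im (f p))) => [|q r|a q]; first last.
  by rewrite fZ /Im /=; ring.
  by rewrite fD.
by case: (f p).
Qed.

Lemma momC_poly m (c : nat -> R) n :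
  momC m (\poly_(i < n.+1) c i)%R = sum_n (fun k => RtoC (c k) * m k)%C n.
Proof.
have rec k : (\poly_(i < k.+1) c i = \poly_(i < k) c i + (c k)%:P * 'X^k)%R.
  by rewrite !poly_def big_ord_recr /= mul_polyC.
elim: n => [|n IH]; rewrite rec momC_add momC_scal momC_Xn.
  by rewrite sum_O poly_def big_ord0 momC_0 Cplus_0_l.
by rewrite IH sum_Sn.
Qed.

(** * The moment functional of the weight *)

Section Weight.
Context (a b : R) (ha : -1 < a) (hb : -1 < b) (w0 : R -> R) (Hw0 : jacobi_type a b w0).
Notation w := (weight a b w0).

Definition moment (p : {poly R}) : R := RInt_gen (fun x => peval p x * w x) (at_right 0) (at_left 1).

Lemma momentP p : improper01 (fun x => peval p x * w x) (moment p).
Proof.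
suff [l Hl] : exists l, improper01 (fun x => peval p x * w x) l.
  by rewrite /moment (improper01_RInt_gen _ _ Hl).
suff H n : exists l, improper01 (fun x => (\sum_(i < n) p`_i * x ^+ i)%R * w x) l.
  by case: (H (size p)) => l Hl; exists l; apply: improper01_ext _ _ _ _ Hl => x _; rewrite /peval horner_coef.
elim: n => [|n [l IH]].
  exists 0; apply: improper01_ext _ _ _ _ improper01_0 => x _.
  by rewrite big_ord0 RmultE mul0r.
have [m Hm] := jacobi_moments _ _ _ Hw0 n.
have Im : improper01 (fun x => x ^ n * w x) m.
  apply: (improper01_of_RInt_gen _ _ _ Hm) => x Hx.
  apply: (continuous_mult (K := R_AbsRing)); last exact: (continuous_weight _ _ _ Hw0).
  by apply: (ex_derive_continuous (K := R_AbsRing) (V := R_NormedModule)); auto_derive.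
exists (l + (p`_n)%R * m); apply: (improper01_ext _ _ _ _ (improper01_lin _ _ _ _ (p`_n)%R IH Im)) => x _.
by rewrite big_ord_recr /= RpowE !RplusE !RmultE mulrDl mulrA.
Qed.

Lemma moment_add (p q : {poly R}) : moment (p + q)%R = moment p + moment q.
Proof.
apply: improper01_unique _ _ _ (momentP _) _.
have H := improper01_lin _ _ _ _ 1 (momentP p) (momentP q).
rewrite Rmult_1_l in H; apply: improper01_ext _ _ _ _ H => x _.
rewrite peval_add; ring.
Qed.

Lemma moment_scal c (p : {poly R}) : moment (c%:P * p)%R = c * moment p.
Proof.
apply: improper01_unique _ _ _ (momentP _) _.
have H := improper01_lin _ _ _ _ c improper01_0 (momentP p).
rewrite Rplus_0_l in H; apply: improper01_ext _ _ _ _ H => x _.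
rewrite peval_mul peval_const; ring.
Qed.

(** By [ibp_correct] and v' w = - w', this is the integral of (x - x^2) v' p w over (0,1). *)
Definition ibp (p : {poly R}) : R := moment ((('X - 'X^2) * p)^`())%R.

Lemma ibp_add p q : ibp (p + q)%R = ibp p + ibp q.
Proof. by rewrite /ibp mulrDr derivD moment_add. Qed.

Lemma ibp_scal e p : ibp (e%:P * p)%R = e * ibp p.
Proof. by rewrite /ibp mulrCA mul_polyC derivZ -mul_polyC moment_scal. Qed.

Lemma ibp_correct p :
  improper01 (fun x => (x - x ^ 2) * peval p x * Dweight a b w0 x) (- ibp p).
Proof.
apply: (improper01_parts _ _ _ Hw0 _ (fun x => peval p^`()%R x) _ ha hb).
- by move=> x; apply: is_derive_peval.
- by move=> x; apply: continuous_peval.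
- apply: improper01_ext _ _ _ _ (momentP _) => x _; congr (_ * _).
  have -> : ((('X - 'X^2) * p)^`() = (1%:P + (- 2%:R)%:P * 'X) * p +
      ('X + (- 1)%:P * ('X * 'X)) * p^`())%R.
    rewrite derivM derivB derivX derivXn expr1 expr2 -mulr_natl.
    by rewrite !polyCN polyC_natr polyC1 mulNr mulN1r.
  rewrite !(peval_add, peval_mul) !peval_const !peval_X.
  change (- 2%:R)%R with (- (1 + 1)); change (- 1)%R with (- (1)); change (GRing.one _) with (IZR 1); ring.
Qed.

Section Kernel.
Context (z : C) (dv : C -> C).
Let c : C := ((z - z ^ 2) * dv z)%C.

(** Writing x = z - (z - x) in the integral of x^(k+1) K w gives z times the previous moment minus
    the integral of (z - x) K x^k w, which is regular and known explicitly. *)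
Fixpoint kernel_moments (lam : C) (k : nat) : C :=
  match k with
  | O => lam
  | S k => z * kernel_moments lam k - (c * RtoC (moment 'X^k%R) - RtoC (ibp 'X^k%R))
  end%C.

(* [J lam] is a candidate for [p |-> int01 (K p w)], where [K] is the ladder kernel: it maps 1 to
   [lam] and satisfies the relation [J_X] that [K] has to satisfy because [(z - x) K(x)] is
   regular. *)
Definition J (lam : C) (p : {poly R}) : C := momC (kernel_moments lam) p.

(** Evaluation at a complex point is the functional with moments z^k, so it is handled by the same
    lemmas as [J]. *)
Definition horner_C (p : {poly R}) : C := momC (fun k => z ^ k)%C p.

Lemma J_add lam p q : J lam (p + q)%R = (J lam p + J lam q)%C.
Proof. exact: momC_add. Qed.

Lemma J_scal lam e p : J lam (e%:P * p)%R = (RtoC e * J lam p)%C.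
Proof. exact: momC_scal. Qed.

(** Both sides are linear in [p], and on monomials the identity is the recursion of
    [kernel_moments]. *)
Lemma J_X lam p : J lam ('X * p)%R = (z * J lam p - (c * RtoC (moment p) - RtoC (ibp p)))%C.
Proof.
rewrite [RHS](@momC_repr (fun p => z * J lam p - (c * RtoC (moment p) - RtoC (ibp p)))%C).
- rewrite /J momC_X; apply: momC_ext => k; by rewrite momC_Xn.
- by move=> q r; rewrite /J momC_add moment_add ibp_add !RtoC_plus; ring.
- by move=> e q; rewrite /J momC_scal moment_scal ibp_scal !RtoC_mult; ring.
Qed.

Lemma horner_C_X p : horner_C ('X * p)%R = (z * horner_C p)%C.
Proof.
rewrite [RHS](@momC_repr (fun p => z * horner_C p)%C).
- rewrite /horner_C momC_X; apply: momC_ext => k; by rewrite momC_Xn.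
- by move=> q r; rewrite /horner_C momC_add; ring.
- by move=> e q; rewrite /horner_C momC_scal; ring.
Qed.

Lemma horner_C_add p q : horner_C (p + q)%R = (horner_C p + horner_C q)%C.
Proof. exact: momC_add. Qed.

Lemma horner_C_scal e p : horner_C (e%:P * p)%R = (RtoC e * horner_C p)%C.
Proof. exact: momC_scal. Qed.

Lemma horner_C_MXaddC p e : horner_C (p * 'X + e%:P)%R = (z * horner_C p + RtoC e)%C.
Proof. rewrite mulrC horner_C_add horner_C_X /horner_C momC_const /=; ring. Qed.

(** The function (p(x) - p(z)) K w is regular, because z - x divides p(z) - p(x), and is therefore
    integrable even when K w is not. The claim follows by induction along the Horner scheme, with
    [f] as this regular part. *)
Lemma kernel_decomposition lam p : exists f : R -> C,
  is_int01 z f (J lam p - horner_C p * lam)%C /\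
  forall x, 0 < x < 1 -> RtoC x <> z ->
    (ladder_kernel w dv z x * RtoC (peval p x * w x) =
     horner_C p * (ladder_kernel w dv z x * RtoC (w x)) + f x)%C.
Proof.
elim/poly_ind: p => [|p e [f [If Ef]]].
  exists (fun=> RtoC 0); split.
    have -> : (J lam 0%R - horner_C 0%R * lam)%C = RtoC 0.
      by rewrite /J /horner_C !momC_0; ring.
    exact: (is_int01_RtoC _ _ _ improper01_0).
  move=> x _ _; rewrite /horner_C momC_0 /peval horner0 Rmult_0_l.
  ring.
(* [g] is (z - x) K p w written without the denominator; its integral is known from the moments and
   from integration by parts. *)
pose g x : C := (c * RtoC (peval p x * w x) + 1 * RtoC ((x - x ^ 2) * peval p x * Dweight a b w0 x))%C.
have I00 := is_int01_RtoC z _ _ improper01_0.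
have Ig : is_int01 z g (c * RtoC (moment p) - RtoC (ibp p))%C.
  have I0 := is_int01_lin _ _ _ _ _ c I00 (is_int01_RtoC z _ _ (momentP p)).
  have := is_int01_lin _ _ _ _ _ (RtoC 1) I0 (is_int01_RtoC z _ _ (ibp_correct p)).
  have -> : (0 + c * RtoC (moment p) + 1 * RtoC (- ibp p) = c * RtoC (moment p) - RtoC (ibp p))%C.
    by rewrite RtoC_opp; ring.
  by apply: is_int01_ext => x _ _; rewrite /g; ring.
(* From x = z - (z - x), the regular part for p X + e is z f - g. The added zero function gives a
   scalar multiple the shape that [is_int01_lin] produces. *)
exists (fun x => (RtoC 0 + z * f x) + -1 * g x)%C; split.
  have -> : (J lam (p * 'X + e%:P)%R - horner_C (p * 'X + e%:P)%R * lam =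
     RtoC 0 + z * (J lam p - horner_C p * lam) + -1 * (c * RtoC (moment p) - RtoC (ibp p)))%C.
    rewrite horner_C_MXaddC mulrC /J momC_add momC_const -/(J lam _) J_X -/(J lam p) /=; ring.
  exact: is_int01_lin (is_int01_lin _ _ _ _ _ z I00 If) Ig.
move=> x Hx Hz.
rewrite horner_C_MXaddC.
have -> : peval (p * 'X + e%:P)%R x = peval p x * x + e.
  by rewrite peval_add peval_mul peval_X peval_const.
have Kg : ((z - RtoC x) * (ladder_kernel w dv z x * RtoC (peval p x * w x)) = g x)%C.
  rewrite /ladder_kernel /g -/c.
  have D := Derive_potential _ _ _ Hw0 x Hx.
  rewrite (_ : (x - x ^ 2) * peval p x * Dweight a b w0 x =
    - ((x - x ^ 2) * Derive (potential w) x * (peval p x * w x))); last first.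
    rewrite -[Dweight _ _ _ _]Ropp_involutive -D; ring.
  rewrite RtoC_opp [RtoC (_ * (peval p x * w x))]RtoC_mult; field.
  move=> E; apply: Hz.
  have : z = (z - RtoC x + RtoC x)%C by ring.
  by rewrite E Cplus_0_l.
rewrite -Kg.
have := Ef x Hx Hz; set K := ladder_kernel w dv z x; set k := horner_C p => E.
have -> : f x = (K * RtoC (peval p x * w x) - k * (K * RtoC (w x)))%C by rewrite E; ring.
rewrite !RtoC_mult !RtoC_plus !RtoC_mult; ring.
Qed.

(** One [lam] serves all polynomials at once, so integrals for different products of the P_n can be
    related through [J] even if some of the integrals in between diverge. *)
Lemma kernel_integral : exists lam : C, forall p v,
  is_int01 z (fun x => ladder_kernel w dv z x * RtoC (peval p x * w x))%C v -> v = J lam p.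
Proof.
set K := ladder_kernel w dv z.
case: (Classical_Prop.classic (exists lam, is_int01 z (fun x => K x * RtoC (w x))%C lam)).
  case=> lam Hlam; exists lam => p v Hv.
  have [f [If Ef]] := kernel_decomposition lam p.
  apply: is_int01_unique Hv _.
  have -> : J lam p = (J lam p - horner_C p * lam + horner_C p * lam)%C by ring.
  apply: is_int01_ext (is_int01_lin _ _ _ _ _ (horner_C p) If Hlam) => x Hx Hz.
  by rewrite /K Ef //; ring.
move=> nconv; exists (RtoC 0) => p v Hv.
have [f [If Ef]] := kernel_decomposition (RtoC 0) p.
(* Otherwise K w, being (K p w - f) / p(z), would have a convergent integral. *)
have k0 : horner_C p = RtoC 0.
  apply: Classical_Prop.NNPP => k0; apply: nconv.
  have I00 := is_int01_RtoC z _ _ improper01_0.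
  have I1 := is_int01_lin _ _ _ _ _ (- / horner_C p)%C
    (is_int01_lin _ _ _ _ _ (/ horner_C p)%C I00 Hv) If.
  eexists; apply: is_int01_ext I1 => x Hx Hz.
  by rewrite /K Ef //; field.
apply: is_int01_unique Hv _.
have -> : J (RtoC 0) p = (J (RtoC 0) p - horner_C p * RtoC 0)%C by ring.
apply: is_int01_ext If => x Hx Hz.
by rewrite /K Ef // k0; ring.
Qed.

End Kernel.

(** * Complex derivatives of polynomials *)

Definition dhorner_C z (p : {poly R}) : C := horner_C z p^`()%R.

Lemma dhorner_C_add z p q : dhorner_C z (p + q)%R = (dhorner_C z p + dhorner_C z q)%C.
Proof. by rewrite /dhorner_C derivD horner_C_add. Qed.

Lemma dhorner_C_scal z e p : dhorner_C z (e%:P * p)%R = (RtoC e * dhorner_C z p)%C.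
Proof. by rewrite /dhorner_C mul_polyC derivZ -mul_polyC horner_C_scal. Qed.

Lemma dhorner_C_X z p : dhorner_C z ('X * p)%R = (horner_C z p + z * dhorner_C z p)%C.
Proof. by rewrite /dhorner_C derivM derivX mul1r horner_C_add horner_C_X. Qed.

Lemma is_derive_horner_C z p :
  @is_derive C_AbsRing C_NormedModule (fun y => horner_C y p) z (dhorner_C z p).
Proof.
elim/poly_ind: p => [|p c IH].
  rewrite /dhorner_C derivC /horner_C momC_0.
  apply: (is_derive_ext (fun=> RtoC 0)) => [y|]; first by rewrite momC_0.
  exact: is_derive_const.
apply: (is_derive_ext (fun y => y * horner_C y p + RtoC c)%C) => [y|].
  by rewrite horner_C_MXaddC.
have -> : dhorner_C z (p * 'X + c%:P)%R = (1 * horner_C z p + z * dhorner_C z p + 0)%C.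
  rewrite mulrC dhorner_C_add dhorner_C_X /dhorner_C derivC {3}/horner_C momC_0; ring.
apply: (@is_derive_plus C_AbsRing C_NormedModule (fun y => y * horner_C y p)%C).
  exact: is_derive_C_mult (is_derive_C_id z) IH.
exact: is_derive_const.
Qed.

(** * The orthogonal polynomials of the weight *)

Section Orthogonal.
Context (P : nat -> nat -> R) (h : nat -> R) (hP : monic_orthogonal w P h).
Local Notation p := (pol P).

Lemma size_pol n : size (p n) = n.+1.
Proof. by rewrite size_poly_eq // (mo_monic _ _ _ hP) oner_neq0. Qed.

Lemma coef_pol n k : (k <= n)%N -> ((p n)`_k)%R = P n k.
Proof. by move=> kn; rewrite coef_poly ltnS kn. Qed.

Lemma moment_pol i j : moment (p i * p j)%R = if i == j then h j else 0.
Proof.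
apply: improper01_unique (momentP _) _.
have H : is_RInt_gen (fun x => poly_R P i x * poly_R P j x * w x) (at_right 0) (at_left 1)
    (if i == j then h j else 0).
  have := mo_orthogonal _ _ _ hP i j.
  by case: Nat.eq_dec => E; [rewrite (introT eqP E) | rewrite (introF eqP E)].
apply: (improper01_ext (fun x => poly_R P i x * poly_R P j x * w x)) => [x _|].
  by rewrite peval_mul !peval_pol.
apply: (improper01_of_RInt_gen _ _ _ H) => x Hx.
apply: (continuous_mult (K := R_AbsRing)); last exact: (continuous_weight _ _ _ Hw0).
apply: (continuous_ext (peval (p i * p j)%R)); last exact: continuous_peval.
by move=> y; rewrite peval_mul !peval_pol.
Qed.

(** P_n is a nonzero polynomial, hence nonzero somewhere in (0,1), and there the nonnegative
    integrand P_n^2 w is positive. *)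
Lemma norm_pos n : 0 < h n.
Proof.
have nz : p n != 0%R by rewrite -size_poly_eq0 size_pol.
have [x [Hx Px]] := peval_neq0_01 _ nz.
have -> : h n = moment (p n * p n)%R by rewrite moment_pol eqxx.
apply: (improper01_pos _ _ x _ Hx _ (momentP _)) => [y Hy|]; rewrite peval_mul.
  apply: Rmult_le_pos; first exact: Rle_0_sqr.
  by left; apply: (weight_pos _ _ _ Hw0).
apply: Rmult_lt_0_compat; first exact: Rsqr_pos_lt.
exact: (weight_pos _ _ _ Hw0).
Qed.

Lemma subl_pol n : subl p n = subleading P n.
Proof. by case: n => // n; rewrite /subl coef_pol. Qed.

Lemma al_pol n : al p n = rec_alpha P n.
Proof. by rewrite /al !subl_pol. Qed.

Lemma be_pol n : be h n = rec_beta h n.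
Proof. by case: n => // n; rewrite /be /rec_beta RdivE. Qed.

Let h_neq0 n : (h n != 0)%R.
Proof. by apply/eqP; apply: Rgt_not_eq; apply: norm_pos. Qed.

Let monic_pol n : ((p n)`_n = 1)%R.
Proof. by rewrite coef_pol // (mo_monic _ _ _ hP). Qed.

Lemma recurrence_pol n :
  ('X * p n = p n.+1 + (rec_alpha P n)%:P * p n + (rec_beta h n)%:P * Pprev p n)%R.
Proof.
rewrite -al_pol -be_pol.
exact: (recurrence moment_add moment_scal size_pol monic_pol moment_pol h_neq0).
Qed.

Lemma ibp_square n : ibp (p n * p n)%R =
  ((2 * INR n + 1) * (1 - rec_alpha P n) + subleading P n + subleading P n.+1) * h n.
Proof.
rewrite /ibp (L_ibp_square moment_add moment_scal size_pol monic_pol moment_pol).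
by rewrite al_pol !subl_pol INRE.
Qed.

Lemma ibp_step n : ibp (step p h n) =
  (rec_alpha P n - rec_alpha P n ^ 2) * h n - (2 * INR n + 3) * h n.+1
  + (2 * INR n - 1) * (rec_beta h n * h n).
Proof.
rewrite /ibp -stepE.
rewrite (L_ibp_step moment_add moment_scal size_pol monic_pol moment_pol h_neq0).
by rewrite al_pol be_pol INRE RpowE.
Qed.

Lemma moment_step n : moment (step p h n) = 0.
Proof. exact: (L_step moment_add moment_scal moment_pol). Qed.

Section Data.
Context (z : C) (dv : C -> C) (lam : C).
Local Notation Jz := (J z dv lam).
Local Open Scope C_scope.

(** The rule [J_X] at P_n^2; divided by h_n (z - z^2) it becomes the first compatibility
    relation. *)
Lemma J_square_relation n :
  Jz (p n.+1 * p n)%R + RtoC (rec_alpha P n) * Jz (p n * p n)%R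
    + RtoC (rec_beta h n) * Jz (p n * Pprev p n)%R =
  z * Jz (p n * p n)%R - ((z - z ^ 2) * dv z * RtoC (h n) - RtoC (ibp (p n * p n)%R)).
Proof.
have := J_X z dv lam (p n * p n)%R.
rewrite (X_square moment_add moment_scal size_pol monic_pol moment_pol h_neq0).
by rewrite moment_pol eqxx al_pol be_pol !J_add !J_scal.
Qed.

(** The rule [J_X] at [step]. Since L(step) = 0, the term with v'(z) drops out, which is why the
    second compatibility relation does not contain v'(z). *)
Lemma J_step_relation n :
  Jz (p n.+1 * p n.+1)%R + RtoC (rec_alpha P n) * Jz (p n.+1 * p n)%R
    + RtoC (- (rec_alpha P n * rec_beta h n)) * Jz (p n * Pprev p n)%R
    + RtoC (- rec_beta h n ^ 2) * Jz (Pprev p n * Pprev p n)%R =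
  z * (Jz (p n.+1 * p n)%R + RtoC (- rec_beta h n) * Jz (p n * Pprev p n)%R)
    + RtoC (ibp (step p h n)).
Proof.
have Jstep : Jz (step p h n) =
    Jz (p n.+1 * p n)%R + RtoC (- rec_beta h n) * Jz (p n * Pprev p n)%R.
  by rewrite /step be_pol J_add J_scal.
have := J_X z dv lam (step p h n); rewrite Jstep.
rewrite (X_step moment_add moment_scal size_pol monic_pol moment_pol h_neq0).
rewrite moment_step be_pol al_pol !J_add !J_scal -RpowE => ->; ring.
Qed.

Lemma poly_C_horner n : poly_C P n z = horner_C z (p n).
Proof. by rewrite /horner_C momC_poly. Qed.

Lemma prev_poly_C_horner n : prev_poly_C P n z = horner_C z (Pprev p n).
Proof. by case: n => [|n]; [rewrite /horner_C momC_0 | exact: poly_C_horner]. Qed.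

Lemma is_derive_poly_C n :
  @is_derive C_AbsRing C_NormedModule (poly_C P n) z (dhorner_C z (p n)).
Proof.
apply: is_derive_ext (is_derive_horner_C z (p n)) => y.
by rewrite /poly_C /horner_C momC_poly.
Qed.

Lemma poly_C_recurrence n : poly_C P n.+1 z =
  (z - RtoC (rec_alpha P n)) * poly_C P n z - RtoC (rec_beta h n) * prev_poly_C P n z.
Proof.
have := horner_C_X z (p n); rewrite recurrence_pol !horner_C_add !horner_C_scal.
rewrite prev_poly_C_horner !poly_C_horner => E.
rewrite (_ : (z - RtoC (rec_alpha P n)) * horner_C z (p n) =
  z * horner_C z (p n) - RtoC (rec_alpha P n) * horner_C z (p n)); last by ring.
by rewrite -E; ring.
Qed.

Lemma deriv_poly_C_recurrence n : dhorner_C z (p n.+1) =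
  poly_C P n z + (z - RtoC (rec_alpha P n)) * dhorner_C z (p n)
    - RtoC (rec_beta h n) * dhorner_C z (Pprev p n).
Proof.
have := dhorner_C_X z (p n).
rewrite recurrence_pol !dhorner_C_add !dhorner_C_scal poly_C_horner => E.
rewrite (_ : horner_C z (p n) + (z - RtoC (rec_alpha P n)) * dhorner_C z (p n) =
  (horner_C z (p n) + z * dhorner_C z (p n))
  - RtoC (rec_alpha P n) * dhorner_C z (p n)); last by ring.
by rewrite -E; ring.
Qed.

End Data.

(** Everything that the remaining algebra needs, in terms of sequences of complex numbers. [ja n]
    and [jb n] extend the integrals of P_n^2 and P_n P_{n-1}; as [B_integrand] at n belongs to
    B_{n+1}, it corresponds to [jb] at n + 1. [q n] is the derivative of P_n at z. *)
Lemma ladder_data (z : C) (dv : C -> C) : exists ja jb q : nat -> C,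
  (forall n, A_converges w P dv n z -> int01 (A_integrand w P dv n z) z = ja n) /\
  (forall n, B_converges w P dv n.+1 z -> int01 (B_integrand w P dv n z) z = jb n.+1) /\
  jb 0%N = RtoC 0 /\
  (forall n, jb n.+1 + RtoC (rec_alpha P n) * ja n + RtoC (rec_beta h n) * jb n =
    z * ja n - ((z - z ^ 2) * dv z * RtoC (h n) -
      RtoC (((2 * INR n + 1) * (1 - rec_alpha P n) + subleading P n + subleading P n.+1) * h n)))%C /\
  (forall n, ja n.+1 + RtoC (rec_alpha P n) * jb n.+1
      + RtoC (- (rec_alpha P n * rec_beta h n)) * jb n
      + RtoC (- rec_beta h n ^ 2) * Defs.prev (RtoC 0) ja n =
    z * (jb n.+1 + RtoC (- rec_beta h n) * jb n) +
      RtoC ((rec_alpha P n - rec_alpha P n ^ 2) * h n - (2 * INR n + 3) * h n.+1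
        + (2 * INR n - 1) * (rec_beta h n * h n)))%C /\
  (forall n, @is_derive C_AbsRing C_NormedModule (poly_C P n) z (q n)) /\
  poly_C P 0 z = RtoC 1 /\ q 0%N = RtoC 0 /\
  (forall n, poly_C P n.+1 z = (z - RtoC (rec_alpha P n)) * poly_C P n z
     - RtoC (rec_beta h n) * Defs.prev (RtoC 0) (fun m => poly_C P m z) n)%C /\
  (forall n, q n.+1 = poly_C P n z + (z - RtoC (rec_alpha P n)) * q n
     - RtoC (rec_beta h n) * Defs.prev (RtoC 0) q n)%C.
Proof.
have [lam Hlam] := kernel_integral z dv.
exists (fun n => J z dv lam (p n * p n)%R), (fun n => J z dv lam (p n * Pprev p n)%R),
  (fun n => dhorner_C z (p n)).
split; [|split; [|split; [|split; [|split; [|split; [|split; [|split; [|split]]]]]]]].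
- move=> n /is_int01_correct H; apply: Hlam; apply: is_int01_ext H => x _ _.
  by rewrite /A_integrand peval_mul !peval_pol /= Rmult_1_r.
- move=> n /is_int01_correct H; apply: Hlam; apply: is_int01_ext H => x _ _.
  by rewrite /B_integrand peval_mul !peval_pol.
- by rewrite /J mulr0 momC_0.
- by move=> n; rewrite -ibp_square; apply: J_square_relation.
- move=> n; rewrite -ibp_step -J_step_relation; congr (_ + RtoC _ * _)%C.
  by case: n => [|n] //=; rewrite mulr0 /J momC_0.
- exact: is_derive_poly_C.
- by rewrite /poly_C sum_O (mo_monic _ _ _ hP); apply: Cmult_1_r.
- by rewrite /dhorner_C (size1_polyC (p := p 0%N)) ?size_pol // derivC /horner_C momC_0.
- exact: poly_C_recurrence.
- move=> n; rewrite deriv_poly_C_recurrence; congr (_ - RtoC _ * _)%C.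
  by case: n => [|n] //=; rewrite /dhorner_C derivC /horner_C momC_0.
Qed.

End Orthogonal.
End Weight.
End PolynomialMoments.

(** * Ladder operators *)

Section LadderRelations.
Local Open Scope C_scope.
Context (z v : C) (al be : nat -> C) (AA BB p q : nat -> C).
Context (be0 : be 0 = 0) (BB0 : BB 0 = 0).
Context (S1 : forall n, BB (S n) + BB n = (z - al n) * AA n - v).
Context (S2 : forall n, 1 + (z - al n) * (BB (S n) - BB n) =
   be (S n) * AA (S n) - be n * prev (RtoC 0) AA n).
Context (p0 : p 0 = 1) (q0 : q 0 = 0).
Context (prec : forall n, p (S n) = (z - al n) * p n - be n * prev (RtoC 0) p n).
Context (qrec : forall n, q (S n) = p n + (z - al n) * q n - be n * prev (RtoC 0) q n).

(* [q n] stands for the derivative of [p n]; lowering at [n] and (S1) give raising at [n + 1],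
   and raising at [n + 1], raising at [n] and (S2) give lowering at [n + 1]. *)
Lemma ladder_relations n :
  q n = - BB n * p n + be n * AA n * prev (RtoC 0) p n /\
  prev (RtoC 0) q n = (BB n + v) * prev (RtoC 0) p n - prev (RtoC 0) AA n * p n.
Proof.
induction n as [|n [IH1 IH2]].
- simpl; rewrite q0, BB0, be0, p0; split; ring.
- assert (E : q n = (BB (S n) + v) * p n - AA n * p (S n)).
  { replace (BB (S n)) with ((z - al n) * AA n - v - BB n) by (rewrite <- S1; ring).
    rewrite prec, IH1; ring. }
  split; [|exact E].
  change (prev (RtoC 0) p (S n)) with (p n).
  replace (be (S n) * AA (S n)) with
    (1 + (z - al n) * (BB (S n) - BB n) + be n * prev (RtoC 0) AA n) by (rewrite S2; ring).
  rewrite qrec, E, IH2.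
  assert (HB : (z - al n) * AA n = BB (S n) + BB n + v) by (rewrite S1; ring).
  replace ((z - al n) * ((BB (S n) + v) * p n - AA n * p (S n)))
    with ((z - al n) * (BB (S n) + v) * p n - ((z - al n) * AA n) * p (S n)) by ring.
  rewrite HB, prec; ring.
Qed.

Lemma sum_rule n :
  BB (S n) ^ 2 + v * BB (S n) + sum_n AA n = be (S n) * AA (S n) * AA n.
Proof.
(* (S2) times A_k, where (S1) replaces (z - al_k) A_k by B_{k+1} + B_k + v; its product with B_{k+1}
   - B_k is a difference of consecutive terms. *)
assert (step : forall k, be (S k) * AA (S k) * AA k - be k * AA k * prev (RtoC 0) AA k =
   AA k + BB (S k) ^ 2 - BB k ^ 2 + v * (BB (S k) - BB k)).
{ intros k.
  replace (be (S k) * AA (S k) * AA k - be k * AA k * prev (RtoC 0) AA k)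
    with ((be (S k) * AA (S k) - be k * prev (RtoC 0) AA k) * AA k) by ring.
  rewrite <- S2.
  replace ((1 + (z - al k) * (BB (S k) - BB k)) * AA k) with
    (AA k + ((z - al k) * AA k) * (BB (S k) - BB k)) by ring.
  replace ((z - al k) * AA k) with (BB (S k) + BB k + v) by (rewrite S1; ring).
  ring. }
induction n as [|n IH].
- rewrite sum_O; specialize (step 0%nat); rewrite BB0, be0 in step; simpl prev in step.
  replace (be 1 * AA 1 * AA 0) with (be 1 * AA 1 * AA 0 - 0 * AA 0 * 0) by ring.
  rewrite step; ring.
- rewrite sum_Sn; specialize (step (S n)); simpl prev in step.
  replace (be (S (S n)) * AA (S (S n)) * AA (S n)) with
    (be (S (S n)) * AA (S (S n)) * AA (S n) - be (S n) * AA (S n) * AA n + be (S n) * AA (S n) * AA n) by ring.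
  rewrite step, <- IH; change plus with Cplus; ring.
Qed.

End LadderRelations.

(** * From the extended integrals to the theorem *)

Lemma admissible_neq0 w dv z : admissible w dv z -> (z - z ^ 2 <> 0)%C.
Proof.
intros Hz E.
assert (F : (z * (1 - z) = 0)%C) by (rewrite <- E; ring).
assert (Hz01 : z = RtoC 0 \/ z = RtoC 1).
{ destruct (Classical_Prop.classic (z = RtoC 0)) as [|H0]; [now left|right].
  replace (RtoC 1) with (z + / z * (z * (1 - z)))%C by (field; trivial).
  rewrite F; ring. }
destruct Hz as [[x [Hx [-> _]]] | [Hz _]].
- destruct Hz01 as [H|H]; apply RtoC_inj in H; lra.
- apply Hz; destruct Hz01 as [-> | ->]; [exists 0 | exists 1]; split; trivial; lra.
Qed.

Local Ltac push_RtoC :=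
  repeat (rewrite RtoC_mult || rewrite RtoC_plus || rewrite RtoC_minus ||
          rewrite RtoC_div || rewrite RtoC_opp).

Theorem theorem5p1 (a b : R) (ha : -1 < a) (hb : -1 < b)
    (w0 : R -> R) (hw0 : jacobi_type a b w0)
    (w : R -> R) (hw : w = weight a b w0)
    (P : nat -> nat -> R) (h : nat -> R) (hP : monic_orthogonal w P h)
    (dv : C -> C) (z : C) (hz : admissible w dv z) :
  (forall n : nat,
     A_converges w P dv n z -> B_converges w P dv n z ->
     @is_derive C_AbsRing C_NormedModule (poly_C P n) z
       (- B w P h dv n z * poly_C P n z
        + RtoC (rec_beta h n) * A w P h dv n z * prev_poly_C P n z)%C) /\
  (forall n : nat,
     prev_A_converges w P dv n z -> B_converges w P dv n z ->
     @is_derive C_AbsRing C_NormedModule (prev_poly_C P n) z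
       ((B w P h dv n z + dv z) * prev_poly_C P n z
        - prev_A w P h dv n z * poly_C P n z)%C) /\
  (forall n : nat,
     A_converges w P dv n z ->
     B_converges w P dv n z -> B_converges w P dv (S n) z ->
     (B w P h dv (S n) z + B w P h dv n z
      = (z - RtoC (rec_alpha P n)) * A w P h dv n z - dv z)%C) /\
  (forall n : nat,
     A_converges w P dv (S n) z -> prev_A_converges w P dv n z ->
     B_converges w P dv n z -> B_converges w P dv (S n) z ->
     (1 + (z - RtoC (rec_alpha P n)) * (B w P h dv (S n) z - B w P h dv n z)
      = RtoC (rec_beta h (S n)) * A w P h dv (S n) z
        - RtoC (rec_beta h n) * prev_A w P h dv n z)%C) /\
  (forall n : nat, (1 <= n)%nat ->
     (forall j : nat, (j <= n)%nat -> A_converges w P dv j z) ->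
     B_converges w P dv n z ->
     (B w P h dv n z ^ 2 + dv z * B w P h dv n z
        + sum_n (fun j : nat => A w P h dv j z) (n - 1)
      = RtoC (rec_beta h n) * A w P h dv n z * prev_A w P h dv n z)%C).
Proof.
assert (Z := admissible_neq0 _ _ _ hz); subst w; set (w := weight a b w0) in *.
assert (hR : forall n, h n <> 0).
{ intros n; apply Rgt_not_eq, (PolynomialMoments.norm_pos a b w0 hw0 P h hP n). }
assert (hC : forall n, RtoC (h n) <> RtoC 0).
{ intros n H; now apply RtoC_inj, hR in H. }
destruct (PolynomialMoments.ladder_data a b ha hb w0 hw0 P h hP z dv) as
  [ja [jb [q [Hja [Hjb [jb0 [H3 [H4 [Hq [p0 [q0 [prec qrec]]]]]]]]]]]].
fold w in Hja, Hjb.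
(* A_n and B_n with extended integrals: these are meaningful for every n and agree with [A] and [B]
   wherever the integrals converge, so the inductions may pass through indices at which they do
   not. *)
set (AA := fun n : nat =>
  (/ (z - z ^ 2) * (/ RtoC (h n) * ja n + RtoC (2 * INR n + 1)))%C).
set (BB := fun n : nat => match n with
  | O => RtoC 0
  | S m => (/ (z - z ^ 2) * (/ RtoC (h m) * jb n + RtoC (INR n) * (z - 1)
      - RtoC (subleading P n)))%C end).
assert (EA : forall n, A_converges w P dv n z -> A w P h dv n z = AA n).
{ intros n Hn; unfold A, AA; now rewrite Hja. }
assert (EpA : forall n, prev_A_converges w P dv n z -> prev_A w P h dv n z = prev (RtoC 0) AA n).
{ intros [|n] Hn; [easy | now apply EA]. }
assert (EB : forall n, B_converges w P dv n z -> B w P h dv n z = BB n).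
{ intros [|n] Hn; [easy|]; unfold B, BB; now rewrite Hjb. }
assert (S1 : forall n, (BB (S n) + BB n = (z - RtoC (rec_alpha P n)) * AA n - dv z)%C).
{ intros n; specialize (H3 n).
  assert (E : jb (S n) = (z * ja n - ((z - z ^ 2) * dv z * RtoC (h n) -
      RtoC (((2 * INR n + 1) * (1 - rec_alpha P n) + subleading P n + subleading P (S n)) * h n))
      - RtoC (rec_alpha P n) * ja n - RtoC (rec_beta h n) * jb n)%C).
  (* It remains to divide by h_n (z - z^2). For n > 0 the quotient be_n / h_n is 1 / h_{n-1}, the
     normalization of B_n; for n = 0 the term is absent. *)
  { rewrite <- H3; ring. }
  unfold AA, BB; rewrite E, S_INR; unfold rec_alpha.
  destruct n as [|m]; unfold rec_beta.
  - rewrite jb0; simpl (INR 0); simpl (subleading P 0).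
    push_RtoC.
    all: auto; field; auto.
  - rewrite S_INR.
    push_RtoC.
    all: auto; field; auto. }
assert (S2 : forall n, (1 + (z - RtoC (rec_alpha P n)) * (BB (S n) - BB n) =
  RtoC (rec_beta h (S n)) * AA (S n) - RtoC (rec_beta h n) * prev (RtoC 0) AA n)%C).
{ intros n; specialize (H4 n).
  assert (E : ja (S n) = (z * (jb (S n) + RtoC (- rec_beta h n) * jb n) +
      RtoC ((rec_alpha P n - rec_alpha P n ^ 2) * h n - (2 * INR n + 3) * h (S n)
        + (2 * INR n - 1) * (rec_beta h n * h n))
      - RtoC (rec_alpha P n) * jb (S n)
      - RtoC (- (rec_alpha P n * rec_beta h n)) * jb n
      - RtoC (- rec_beta h n ^ 2) * prev (RtoC 0) ja n)%C).
  (* Again a division by h_n (z - z^2): 1 / h_n is be_{n+1} / h_{n+1}, and for n > 0 also be_n^2 /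
     h_n is be_n / h_{n-1}, which yields be_{n+1} A_{n+1} and be_n A_{n-1}. *)
  { rewrite <- H4; ring. }
  unfold AA at 1; unfold BB; rewrite E, S_INR; unfold rec_alpha.
  destruct n as [|m]; unfold rec_beta; simpl (prev _ _ _); unfold AA.
  - rewrite jb0; simpl (INR 0); simpl (subleading P 0); unfold pow.
    push_RtoC.
    all: auto; field; auto.
  - rewrite S_INR; unfold pow.
    push_RtoC.
    all: auto; field; auto. }
assert (ladder := ladder_relations z (dv z) (fun n => RtoC (rec_alpha P n))
  (fun n => RtoC (rec_beta h n)) AA BB (fun n => poly_C P n z) q
  (eq_refl _) (eq_refl _) S1 S2 p0 q0 prec qrec).
split; [|split; [|split; [|split]]].
- intros n HA HB; rewrite (EA n HA), (EB n HB).
  assert (E := proj1 (ladder n)); simpl in E; unfold prev_poly_C; rewrite <- E; apply Hq.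
- intros n HA HB; rewrite (EpA n HA), (EB n HB).
  assert (E := proj2 (ladder n)); unfold prev_poly_C at 2; rewrite <- E.
  destruct n as [|m]; [apply (is_derive_const (V := C_NormedModule)) | apply Hq].
- intros n HA HB HB'; rewrite (EA n HA), (EB n HB), (EB _ HB'); apply S1.
- intros n HA HA' HB HB'; rewrite (EA _ HA), (EpA _ HA'), (EB n HB), (EB _ HB'); apply S2.
- intros [|m] Hm HA HB; [inversion Hm|].
  (* The upper bound of [sum_n] is inclusive, so for n = m + 1 the sum ends at A_m. *)
  replace (S m - 1)%nat with m by (simpl; now rewrite Nat.sub_0_r).
  rewrite (EB _ HB), (EA _ (HA _ (le_n _))).
  change (prev_A w P h dv (S m) z) with (A w P h dv m z); rewrite (EA m (HA m (le_S _ _ (le_n _)))).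
  rewrite (sum_n_ext_loc _ AA); [|intros k Hk; apply EA, HA; now apply le_S].
  exact (sum_rule z (dv z) (fun n => RtoC (rec_alpha P n))
    (fun n => RtoC (rec_beta h n)) AA BB (eq_refl _) (eq_refl _) S1 S2 m).
Qed.
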